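(* Let $B$ be a nonzero unital complex Banach algebra with unit $e$, let $b\in B$ be invertible, and let $\lambda_1,\dots,\lambda_n\in\mathbb{C}$ be distinct ($n\ge 1$). The following are equivalent: (i) $b$ is doubly power-bounded and $\sigma(b)=\{\lambda_1,\dots,\lambda_n\}$; (ii) $\{\lambda_1,\dots,\lambda_n\}\subset\mathbb{T}$, and there exist non-zero idempotents $p_1,\dots,p_n\in B$ such that $\sum_{j=1}^n p_j=e$ and $p_ip_j=\delta_{ij}p_i$ for $1\le i,j\le n$, which satisfy \[ b=\sum_{j=1}^n\lambda_jp_j; \] (iii) $\{\lambda_1,\dots,\lambda_n\}\subset\mathbb{T}$, and $b$ is algebraic in the sense that \[ \prod_{j=1}^n(b-\lambda_je)=0, \] and, defining \[ p_i=\prod_{j=1,\,j\ne i}^n\frac{b-\lambda_je}{\lambda_i-\lambda_j}\quad (1\le i\le n)\ \text{ if } n>1,\qquad p_1=e\ \text{ if } n=1, \] we have $p_i\neq 0$ for every $1\le i\le n$. In this case, if $n>1$, then $p_i$ is the Riesz projection corresponding to $\lambda_i$ for every $1\le i\le n$.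
   Context: $\mathbb{T}$ denotes the unit circle in $\mathbb{C}$; $\delta_{ij}=1$ if $i=j$ and $\delta_{ij}=0$ otherwise. An invertible element $x\in B$ is called doubly power-bounded if $\sup_{m\in\mathbb{Z}}\|x^m\|<\infty$. An idempotent is an element $a$ with $a^2=a$. $\sigma(b)$ is the spectrum of $b$ in $B$. For $a\in B$ and an isolated point $\lambda$ of $\sigma(a)$, the Riesz projection corresponding to $\lambda$ is \[ p=\frac{1}{2\pi i}\int_\Gamma (a-wI)^{-1}\,dw, \] where $I$ here stands for the unit $e$ and $\Gamma$ is a Cauchy contour in the resolvent set $\mathbb{C}\setminus\sigma(a)$ around $\lambda$ separating $\lambda$ from $\sigma(a)\setminus\{\lambda\}$; it does not depend on the choice of $\Gamma$. The orientation of $\Gamma$ is the one making $p$ an idempotent, i.e. $p=\frac{1}{2\pi i}\int (we-a)^{-1}\,dw$ over the counterclockwise contour. *)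

(* Defs.v *)
From HB Require Import structures.
From mathcomp Require Import all_boot all_order all_algebra.
From mathcomp Require Import complex.
From mathcomp Require Import all_classical all_reals all_analysis.

Set Implicit Arguments.
Unset Strict Implicit.
Unset Printing Implicit Defensive.

Import Order.TTheory GRing.Theory Num.Theory.
Import numFieldNormedType.Exports.

Local Open Scope classical_set_scope.
Local Open Scope ring_scope.
Local Open Scope complex_scope.

(* A plain record rather than an HB structure: normed modules and unit rings
   both lie below numDomainType in the hierarchy, so HB rejects a new join of
   the two. The library structures are recovered on the carrier below. The
   normalization |1| = 1 is not required. *)
Record banachAlgType (K : numFieldType) : Type := BanachAlgebra {
  banach_module : completeNormedModType K;
  banach_one : banach_module;
  banach_mul : banach_module -> banach_module -> banach_module;
  banach_mulA : associative banach_mul;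
  banach_mul1 : left_id banach_one banach_mul;
  banach_mulr1 : right_id banach_one banach_mul;
  banach_mulDl : left_distributive banach_mul +%R;
  banach_mulDr : right_distributive banach_mul +%R;
  banach_one_neq0 : banach_one != 0;
  banach_scaleAl : forall (k : K) (x y : banach_module),
    k *: banach_mul x y = banach_mul (k *: x) y;
  banach_scaleAr : forall (k : K) (x y : banach_module),
    k *: banach_mul x y = banach_mul x (k *: y);
  banach_norm_mul : forall x y : banach_module,
    `|banach_mul x y| <= `|x| * `|y|
}.

Definition banach_sort (K : numFieldType) (B : banachAlgType K) : Type :=
  banach_module B.
Coercion banach_sort : banachAlgType >-> Sortclass.

Section BanachAlgebraInstances.
Context {K : numFieldType} (B : banachAlgType K).

HB.instance Definition _ := CompleteNormedModule.on (banach_sort B).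

HB.instance Definition _ := GRing.Zmodule_isNzRing.Build (banach_sort B)
  (@banach_mulA K B) (@banach_mul1 K B) (@banach_mulr1 K B)
  (@banach_mulDl K B) (@banach_mulDr K B) (@banach_one_neq0 K B).

HB.instance Definition _ :=
  GRing.Lmodule_isLalgebra.Build K (banach_sort B) (@banach_scaleAl K B).

HB.instance Definition _ :=
  GRing.Lalgebra_isAlgebra.Build K (banach_sort B) (@banach_scaleAr K B).

Definition banach_invertible (x : B) : Prop :=
  exists y : B, y * x = 1 /\ x * y = 1.

Definition banach_unit : pred (banach_sort B) :=
  fun x => `[< banach_invertible x >].

Definition banach_inv (x : B) : B :=
  if pselect (banach_invertible x) is left e then projT1 (cid e) else x.

Fact banach_invP : {in banach_unit, left_inverse 1 banach_inv *%R} /\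
  {in banach_unit, right_inverse 1 banach_inv *%R}.
Proof.
by split=> x /asboolP ux; rewrite /banach_inv; case: pselect => // e;
  case: (cid e) => y /= [].
Qed.

Fact banach_unitP (x y : B) : y * x = 1 /\ x * y = 1 -> banach_unit x.
Proof. by move=> xy; apply/asboolP; exists y. Qed.

Fact banach_inv_out : {in [predC banach_unit], banach_inv =1 id}.
Proof.
by move=> x /asboolP nux; rewrite /banach_inv; case: pselect.
Qed.

HB.instance Definition _ := GRing.NzRing_hasMulInverse.Build (banach_sort B)
  (proj1 banach_invP) (proj2 banach_invP) banach_unitP banach_inv_out.

Lemma ler_normM_banach (x y : B) : `|x * y| <= `|x| * `|y|.
Proof. exact: banach_norm_mul. Qed.

End BanachAlgebraInstances.

Section Spectrum.
Context {K : numFieldType} {B : banachAlgType K}.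

Definition spectrum (a : B) : set K^o :=
  [set w : K^o | a - w%:A \isn't a GRing.unit].

Definition doubly_power_bounded (b : B) : Prop :=
  b \is a GRing.unit /\ bounded_set [set b ^ m | m in [set: int]].

End Spectrum.

Section Contours.
Context {R : realType}.
Local Notation C := (R[i]^o).

Definition trace (g : R -> C) : set C := g @` `[0, 1].

Definition rectifiable (g : R -> C) : Prop :=
  exists L : R, forall s : seq R, itv_partition 0 1 s ->
    \sum_(k < size s) `|g s`_k - g (0 :: s)`_k| <= L%:C.

Definition closed_jordan_curve (g : R -> C) : Prop :=
  [/\ {within `[0, 1], continuous g}, g 0 = g 1
    & {in `[0, 1[ &, injective g}].

(* Riemann-Stieltjes integral of f (g t) against dg(t) on [0, 1]: the limit of
   the tagged sums as the mesh of 0 :: s tends to 0. *)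
Definition is_curve_integral (V : normedModType R[i])
    (g : R -> C) (f : C -> V) (v : V) : Prop :=
  forall e : R, 0 < e -> exists2 d : R, 0 < d &
    forall (s : seq R) (t : nat -> R), itv_partition 0 1 s ->
      (forall k, (k < size s)%N ->
        s`_k - (0 :: s)`_k < d /\ (0 :: s)`_k <= t k <= s`_k) ->
      `|\sum_(k < size s) (g s`_k - g (0 :: s)`_k) *: f (g (t k)) - v| < e%:C.

Definition is_contour_integral (V : normedModType R[i]) (m : nat)
    (G : 'I_m -> R -> C) (f : C -> V) (v : V) : Prop :=
  exists2 u : 'I_m -> V,
    forall k, is_curve_integral (G k) f (u k) & v = \sum_(k < m) u k.

Definition two_pi_i : C := 0 +i* (2 * pi).

Definition has_winding_number (m : nat) (G : 'I_m -> R -> C) (z : C) (N : int)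
    : Prop :=
  is_contour_integral G (fun w : C => (w - z)^-1 : C) (two_pi_i * N%:~R).

(* G is the oriented boundary of the bounded Cauchy domain D. Having winding
   number 1 about the points of D and 0 about the exterior points says that
   every component of G is oriented with D on its left, and excludes curves
   along which D lies on both sides. *)
Record cauchy_contour (m : nat) (G : 'I_m -> R -> C) (D : set C) : Prop := {
  cauchy_jordan : forall k, closed_jordan_curve (G k);
  cauchy_rectifiable : forall k, rectifiable (G k);
  cauchy_disjoint : trivIset [set: 'I_m] (fun k => trace (G k));
  cauchy_open : open D;
  cauchy_bounded : bounded_set D;
  cauchy_boundary : closure D `\` D = \bigcup_k trace (G k);
  cauchy_inside : forall z, D z -> has_winding_number G z 1;
  cauchy_outside : forall z, ~ closure D z -> has_winding_number G z 0
}.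

Definition separating_contour (A : set C) (l : C) (m : nat)
    (G : 'I_m -> R -> C) : Prop :=
  exists D : set C, [/\ cauchy_contour G D, D `&` A = [set l]
    & (\bigcup_k trace (G k)) `&` A = set0].

(* The integral is required over every admissible contour; the second clause
   keeps this requirement from being vacuous. *)
Definition is_riesz_projection {B : banachAlgType R[i]} (a : B) (l : C) (p : B)
    : Prop :=
  [/\ isolated (spectrum a) l,
      exists (m : nat) (G : 'I_m -> R -> C),
        separating_contour (spectrum a) l G
    & forall (m : nat) (G : 'I_m -> R -> C),
        separating_contour (spectrum a) l G ->
        exists2 v : B, is_contour_integral G (fun w : C => (w%:A - a)^-1) v
          & p = two_pi_i^-1 *: v].

End Contours.

Section Conditions.
Context {R : realType} {B : banachAlgType R[i]}.

(* The factors commute, so the order of the product is immaterial; for n = 1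
   the product is empty and equals 1. *)
Definition lagrange_idempotent (n : nat) (b : B) (l : 'I_n -> R[i]) (i : 'I_n)
    : B :=
  \prod_(j < n | j != i) ((l i - l j)^-1 *: (b - (l j)%:A)).

Definition spectral_decomposition (n : nat) (b : B) (l : 'I_n -> R[i])
    (p : 'I_n -> B) : Prop :=
  [/\ forall i, p i != 0,
      \sum_(j < n) p j = 1,
      forall i j, p i * p j = (i == j)%:R *: p i
    & b = \sum_(j < n) l j *: p j].

End Conditions.

(* Main.v *)
Require Import Defs.
From HB Require Import structures.
From mathcomp Require Import all_boot all_order all_algebra.
From mathcomp Require Import complex.
From mathcomp Require Import all_classical all_reals all_analysis.
From mathcomp Require Import ring lra.

Set Implicit Arguments.
Unset Strict Implicit.
Unset Printing Implicit Defensive.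

Import Order.TTheory GRing.Theory Num.Theory.
Import numFieldNormedType.Exports.

Local Open Scope classical_set_scope.
Local Open Scope ring_scope.

(** Conditions (ii) and (iii) both say that [b] is a diagonal element
[\sum_j l j *: p j] over a finite resolution [p] of the identity, and Lagrange
interpolation passes from one to the other: once [\prod_j (b - l j)] vanishes,
an identity between polynomials in [b] only has to be checked at the points
[l j] ([horner_alg_eq], [lagrange_resolution], [diagonal_horner]).  A diagonal
element is computed coordinatewise, so with unimodular [l j] it is doubly
power-bounded, with spectrum the set of the [l j]
([diagonal_doubly_power_bounded], [spectrum_diagonal]).

The substance is that a doubly power-bounded [b] whose spectrum is the finite
set of the [l j] is annihilated by [\prod_j (b - l j)].  The Neumann series
puts the spectrum on the unit circle ([spectrum_on_circle]).  Then [1] is cut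
into pieces located along the circle by a discrete Fejer kernel: for [w] a
primitive [N]-th root of unity and [z] a power of [w], let
  [E z = N^-2 * (\sum_(a < N) z^-a b^a) * (\sum_(a < N) z^a b^-a)].
The [N] elements [E (w^i)] sum to [1] ([sum_fejer]).
- Each geometric sum is [1 - b^N], or [1 - b^-N], over [1 - b/z], up to bounded
  factors; so [E z = O(N^-2)] where the resolvent is bounded, and all the mass
  at distance at least [d] from the [l j] is [O(1/N)] ([fejer_mass_far]).
- The mass near [l j] is not small, but its product with [b - l j] is
  [O(d + 1/N)].  A sharp cutoff would cost a logarithm of [N]; averaging it
  over translates by a small arc turns the cutoff into a convolution [u * v],
  whose Fourier coefficients are absolutely summable with a bound independent
  of [N], by Parseval's identity and the inequality between the arithmetic and
  geometric means ([dirichlet_inv_product_bound], [fejer_mass_near]).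
Multiplying [1] by [\prod_j (b - l j)] and letting first [N] tend to infinity
and then [d] to [0] gives [0] ([bounded_annihilator_eq0]).

For the Riesz projections, the resolvent of a diagonal element is
[\sum_j (w - l j)^-1 *: p j], so that its integral over a separating contour is
[\sum_j] of [2 pi i] times the winding number about [l j], times [p j].  The
point [l i] is inside and the other [l j] are outside, so only [p i] survives
([diagonal_riesz_projection]).  A small circle is a separating contour
([circle_separates]); its winding numbers come from expanding [(w - z)^-1] into
a geometric series in [w - c], since among the powers of [w - c] only the
inverse has a nonzero integral ([circle_monomial_integral]). *)

(** * Resolutions of the identity and Lagrange interpolation *)

Section ResolutionsOfIdentity.
Context {K : fieldType} {A : unitAlgType K} {n : nat}.

Definition resolution (p : 'I_n -> A) : Prop :=
  \sum_j p j = 1 /\ forall i j, p i * p j = (i == j)%:R *: p i.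

Definition diagonal (p : 'I_n -> A) (c : 'I_n -> K) : A := \sum_j c j *: p j.

Lemma diagonal_ext p (c d : 'I_n -> K) :
  c =1 d -> diagonal p c = diagonal p d.
Proof. by move=> cd; apply: eq_bigr => j _; rewrite cd. Qed.

Variable p : 'I_n -> A.
Hypothesis p_res : resolution p.

Lemma diagonal1 : diagonal p (fun=> 1) = 1.
Proof. by rewrite -[RHS](proj1 p_res); apply: eq_bigr => j _; rewrite scale1r. Qed.

Lemma diagonalM c d :
  diagonal p c * diagonal p d = diagonal p (fun j => c j * d j).
Proof.
rewrite mulr_suml; apply: eq_bigr => i _; rewrite mulr_sumr (bigD1 i) //=.
rewrite -scalerAl -scalerAr (proj2 p_res) eqxx scale1r scalerA big1 ?addr0 //.
move=> j ji; rewrite -scalerAl -scalerAr (proj2 p_res) eq_sym (negbTE ji).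
by rewrite scale0r !scaler0.
Qed.

Lemma diagonal_delta i : diagonal p (fun j => (j == i)%:R) = p i.
Proof.
rewrite /diagonal (bigD1 i) //= eqxx scale1r big1 ?addr0 // => j /negbTE ->.
by rewrite scale0r.
Qed.

Lemma diagonalBA c w :
  diagonal p c - w%:A = diagonal p (fun j => c j - w).
Proof.
rewrite -diagonal1 /diagonal scaler_sumr -sumrB; apply: eq_bigr => j _.
by rewrite scale1r -scalerBl.
Qed.

Lemma diagonal_horner c (f : {poly K}) :
  horner_alg (diagonal p c) f = diagonal p (fun j => f.[c j]).
Proof.
elim/poly_ind: f => [|f w IH].
  by rewrite rmorph0 /diagonal big1 // => j _; rewrite horner0 scale0r.
rewrite rmorphD rmorphM /= IH horner_algX horner_algC diagonalM.
rewrite -[w]opprK scaleNr diagonalBA; apply: diagonal_ext => j.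
by rewrite !hornerE opprK.
Qed.

Lemma diagonal_unit c : (forall j, c j != 0) ->
  diagonal p c \is a GRing.unit /\
  (diagonal p c)^-1 = diagonal p (fun j => (c j)^-1).
Proof.
move=> c0.
have cV : diagonal p c * diagonal p (fun j => (c j)^-1) = 1.
  by rewrite diagonalM -diagonal1; apply: diagonal_ext => j; rewrite divff.
have Vc : diagonal p (fun j => (c j)^-1) * diagonal p c = 1.
  by rewrite diagonalM -diagonal1; apply: diagonal_ext => j; rewrite mulVf.
have cu : diagonal p c \is a GRing.unit.
  by apply/unitrP; exists (diagonal p (fun j => (c j)^-1)).
split=> //; apply: (mulrI cu); by rewrite divrr.
Qed.

Lemma diagonal_exprz c (m : int) : (forall j, c j != 0) ->
  diagonal p c ^ m = diagonal p (fun j => c j ^ m).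
Proof.
move=> c0.
have H d k : diagonal p d ^+ k = diagonal p (fun j => d j ^+ k).
  elim: k => [|k IH]; first by rewrite expr0 -diagonal1.
  by rewrite exprS IH diagonalM; apply: diagonal_ext => j; rewrite exprS.
case: m => k; first exact: H.
rewrite NegzE -!exprnN -exprVn (proj2 (diagonal_unit c0)) H.
by apply: diagonal_ext => j; rewrite -exprnN exprVn.
Qed.

(** The idempotent [p i] is a zero divisor: it kills every diagonal element whose
[i]-th coordinate is zero. *)
Lemma diagonal_singular c i : p i != 0 -> c i = 0 ->
  diagonal p c \isn't a GRing.unit.
Proof.
move=> pi0 ci; apply/negP => cu; move/eqP: pi0; apply.
apply: (mulrI cu); rewrite mulr0 -[in LHS](diagonal_delta i) diagonalM.
rewrite /diagonal big1 // => j _.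
by have [->|] := eqVneq j i; rewrite ?ci ?mul0r ?mulr0 scale0r.
Qed.

End ResolutionsOfIdentity.

Section Lagrange.
Context {K : fieldType} {A : unitAlgType K} {n : nat}.
Variables (b : A) (l : 'I_n -> K).
Hypothesis l_inj : injective l.

Definition annihilator : {poly K} := \prod_j ('X - (l j)%:P).

Definition lagrange (i : 'I_n) : {poly K} :=
  \prod_(j < n | j != i) ((l i - l j)^-1 *: ('X - (l j)%:P)).

Lemma horner_algXsubC w : horner_alg b ('X - w%:P) = b - w%:A.
Proof. by rewrite rmorphB /= horner_algX horner_algC. Qed.

Lemma horner_algZ w (f : {poly K}) :
  horner_alg b (w *: f) = w *: horner_alg b f.
Proof. by rewrite -mul_polyC rmorphM /= horner_algC mulr_algl. Qed.

Lemma horner_annihilator :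
  horner_alg b annihilator = \prod_j (b - (l j)%:A).
Proof.
by rewrite rmorph_prod; apply: eq_bigr => j _; exact: horner_algXsubC.
Qed.

Lemma horner_lagrange i : horner_alg b (lagrange i) =
  \prod_(j < n | j != i) ((l i - l j)^-1 *: (b - (l j)%:A)).
Proof.
rewrite rmorph_prod; apply: eq_bigr => j _.
by rewrite -horner_algXsubC; exact: horner_algZ.
Qed.

Lemma lagrangeE i k : (lagrange i).[l k] = (i == k)%:R.
Proof.
rewrite horner_prod; have [->|ik] := eqVneq i k.
  rewrite big1 // => j jk; rewrite hornerZ hornerXsubC mulVf // subr_eq0.
  by rewrite (inj_eq l_inj) eq_sym.
by rewrite (bigD1 k) 1?eq_sym //= hornerZ hornerXsubC subrr mulr0 mul0r.
Qed.

Lemma annihilator_dvd (f : {poly K}) :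
  (forall k, f.[l k] = 0) -> annihilator %| f.
Proof.
move=> f0; have -> : annihilator = \prod_(w <- codom l) ('X - w%:P).
  by rewrite /annihilator codomE big_map big_enum.
apply: uniq_roots_dvdp; first by apply/allP => w /codomP[k ->]; apply/rootP.
by rewrite uniq_rootsE; apply/injectiveP.
Qed.

(** The kernel of [f |-> f(b)] contains the annihilator, hence, the points [l k]
being distinct, every polynomial that vanishes at all of them. *)
Lemma horner_alg_eq (f g : {poly K}) : horner_alg b annihilator = 0 ->
  (forall k, f.[l k] = g.[l k]) -> horner_alg b f = horner_alg b g.
Proof.
move=> b0 fg; apply/eqP; rewrite -subr_eq0 -rmorphB; apply/eqP.
have /dvdpP[h ->] : annihilator %| f - g.
  by apply: annihilator_dvd => k; rewrite hornerD hornerN fg subrr.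
by rewrite rmorphM /= b0 mulr0.
Qed.

(** The Lagrange polynomials take the values of the coordinate idempotents at the
points [l k], and [horner_alg_eq] transports to [b] the identities between
these values. *)
Lemma lagrange_resolution : horner_alg b annihilator = 0 ->
  resolution (fun i => horner_alg b (lagrange i)) /\
  b = diagonal (fun i => horner_alg b (lagrange i)) l.
Proof.
move=> b0; split; [split|].
- rewrite -rmorph_sum -[RHS](rmorph1 (horner_alg b)); apply: horner_alg_eq => // k.
  rewrite horner_sum (bigD1 k) //= lagrangeE eqxx big1 ?addr0 ?hornerE //.
  by move=> j /negbTE jk; rewrite lagrangeE jk.
- move=> i j; rewrite -rmorphM /= -horner_algZ; apply: horner_alg_eq => // k.
  rewrite hornerM hornerZ !lagrangeE.
  by have [->|] := eqVneq i j; have [] := eqVneq j k; have [] := eqVneq i k;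
    rewrite ?mulr0 ?mul0r ?mul1r // => -> ->; rewrite eqxx.
- rewrite -[LHS](horner_algX b) /diagonal -(eq_bigr _ (fun j _ => horner_algZ _ _)).
  rewrite -rmorph_sum; apply: horner_alg_eq => // k.
  rewrite horner_sum (bigD1 k) //= hornerX hornerZ lagrangeE eqxx mulr1.
  rewrite big1 ?addr0 // => j /negbTE jk; by rewrite hornerZ lagrangeE jk mulr0.
Qed.

End Lagrange.

(** * The real-valued norm *)

Section RealNorm.
Context {R : realType}.
Local Notation C := R[i].

(** A norm over [R[i]] takes its values in [R[i]], where the order is only partial;
its real part loses nothing and lives in a totally ordered field. *)
Definition rnorm {V : normedZmodType C} (x : V) : R := complex.Re `|x|.

Section NormedZmodule.
Context {V : normedZmodType C}.
Implicit Types (x y : V).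

Lemma rnormE x : `|x| = (rnorm x)%:C%C.
Proof. by rewrite /rnorm RRe_real // normr_real. Qed.

Lemma rnorm_le x (e : R) : (`|x| <= e%:C%C) = (rnorm x <= e).
Proof. by rewrite rnormE lecR. Qed.

Lemma rnorm_lt x (e : R) : (`|x| < e%:C%C) = (rnorm x < e).
Proof. by rewrite rnormE ltcR. Qed.

Lemma rnorm_ge0 x : 0 <= rnorm x.
Proof. by rewrite -ler0c -rnormE. Qed.

Lemma rnorm0 : rnorm (0 : V) = 0.
Proof. by rewrite /rnorm normr0. Qed.

Lemma rnorm_eq0 x : (rnorm x == 0) = (x == 0).
Proof. by rewrite -[RHS]normr_eq0 rnormE eq_complex /= eqxx andbT. Qed.

Lemma rnorm_gt0 x : (0 < rnorm x) = (x != 0).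
Proof. by rewrite lt0r rnorm_eq0 rnorm_ge0 andbT. Qed.

Lemma rnormN x : rnorm (- x) = rnorm x.
Proof. by rewrite /rnorm normrN. Qed.

Lemma rnormD x y : rnorm (x + y) <= rnorm x + rnorm y.
Proof. by rewrite -lecR rmorphD /= -!rnormE ler_normD. Qed.

Lemma rnormB x y : rnorm (x - y) <= rnorm x + rnorm y.
Proof. by rewrite -[rnorm y]rnormN rnormD. Qed.

Lemma rnorm_distC x y : rnorm (x - y) = rnorm (y - x).
Proof. by rewrite -rnormN opprB. Qed.

Lemma rnorm_sum (I : Type) (r : seq I) (P : pred I) (F : I -> V) :
  rnorm (\sum_(i <- r | P i) F i) <= \sum_(i <- r | P i) rnorm (F i).
Proof.
elim/big_rec2: _ => [|i y x _ xy]; first by rewrite rnorm0.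
by rewrite (le_trans (rnormD _ _)) // lerD2l.
Qed.

Lemma ler_rnorm_dist x y : rnorm x - rnorm y <= rnorm (x - y).
Proof. by rewrite lerBlDr -{1}(subrK y x) rnormD. Qed.

End NormedZmodule.

Lemma rnormZ {V : normedModType C} (a : C) (x : V) :
  rnorm (a *: x) = rnorm a * rnorm x.
Proof. by apply: complexI; rewrite rmorphM /= -!rnormE normrZ. Qed.

Lemma rnorm1 : rnorm (1 : C) = 1.
Proof. by rewrite /rnorm normr1. Qed.

Lemma rnormM (x y : C) : rnorm (x * y) = rnorm x * rnorm y.
Proof. by apply: complexI; rewrite rmorphM /= -!rnormE normrM. Qed.

Lemma rnormX (x : C) m : rnorm (x ^+ m) = rnorm x ^+ m.
Proof. by apply: complexI; rewrite rmorphXn /= -!rnormE normrX. Qed.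

Lemma rnormV (x : C) : rnorm x^-1 = (rnorm x)^-1.
Proof. by apply: complexI; rewrite fmorphV /= -!rnormE normfV. Qed.

Lemma rnorm_real (x : R) : rnorm x%:C%C = `|x|.
Proof. by rewrite /rnorm normc_def /= expr0n addr0 sqrtr_sqr. Qed.

Lemma rnorm_nat n : rnorm (n%:R : C) = n%:R.
Proof. by rewrite /rnorm normr_nat -(rmorph_nat (real_complex R)). Qed.

Lemma rnorm_sqr (x : C) : (rnorm x ^+ 2)%:C%C = x * x^*.
Proof. by rewrite rmorphXn /= -rnormE normCK. Qed.

Lemma rnorm_Re (x : C) : `|complex.Re x| <= rnorm x.
Proof. by rewrite -lecR -rnormE normc_ge_Re. Qed.

Lemma rnorm_Im (x : C) : `|complex.Im x| <= rnorm x.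
Proof.
rewrite -[rnorm x]mul1r -rnorm1 (_ : rnorm 1 = rnorm ('i%C : C)); last first.
  by rewrite /rnorm !normc_def /= !expr0n !expr1n addrC.
by rewrite -rnormM mulrC -normrN -ReiNIm rnorm_Re.
Qed.

Lemma rnorm_ReIm (x : C) : rnorm x <= `|complex.Re x| + `|complex.Im x|.
Proof.
rewrite {1}[x]complexE (le_trans (rnormD _ _)) // rnormM !rnorm_real.
by rewrite (_ : rnorm 'i%C = 1) ?mul1r // /rnorm normc_def /= expr0n expr1n add0r sqrtr1.
Qed.

End RealNorm.

(** * Discrete Fourier analysis on the roots of unity *)

Section DiscreteFourier.
Context {R : realType}.
Local Notation C := R[i].
Variables (m : nat) (w : C).
Local Notation N := m.+1.
Hypothesis w_prim : N.-primitive_root w.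

Let w_neq0 : w != 0.
Proof. by rewrite (prim_root_eq0 w_prim). Qed.

Lemma rnorm_root : rnorm w = 1.
Proof.
apply/eqP; rewrite -(@pexpr_eq1 _ _ N) ?rnorm_ge0 // -rnormX.
by rewrite (prim_expr_order w_prim) rnorm1.
Qed.

Lemma rnorm_rootX i : rnorm (w ^+ i) = 1.
Proof. by rewrite rnormX rnorm_root expr1n. Qed.

Lemma conj_root i : (w ^+ i)^* = (w ^+ i)^-1.
Proof.
have w0 : w ^+ i != 0 by rewrite expf_neq0.
by apply: (mulfI w0); rewrite divff // -rnorm_sqr rnorm_rootX expr1n.
Qed.

Lemma root_mul_exprN i j : (w ^+ i * w ^+ j) ^+ N = 1.
Proof.
by rewrite -exprD -exprM mulnC exprM (prim_expr_order w_prim) expr1n.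
Qed.

Lemma root_orthogonality (i k : 'I_N) :
  \sum_(a < N) (w ^+ i) ^+ a * ((w ^+ k) ^+ a)^* = N%:R *+ (i == k).
Proof.
have E (a : 'I_N) : (w ^+ i) ^+ a * ((w ^+ k) ^+ a)^* = (w ^+ i / w ^+ k) ^+ a.
  by rewrite rmorphXn /= conj_root -exprMn.
rewrite (eq_bigr _ (fun a _ => E a)); have [->|ik] := eqVneq i k.
  rewrite divff ?expf_neq0 // (eq_bigr (fun=> 1)) => [|a _]; last exact: expr1n.
  by rewrite sumr_const card_ord.
have z1 : w ^+ i / w ^+ k - 1 != 0.
  rewrite subr_eq0; apply: contra ik => /eqP wik.
  have : w ^+ i == w ^+ k by rewrite -(divfK (expf_neq0 k w_neq0) (w ^+ i)) wik mul1r.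
  by rewrite (eq_prim_root_expr w_prim) !modn_small.
apply: (mulfI z1); rewrite -subrX1 mulr0 exprMn exprVn -!exprM.
by rewrite !(mulnC _ N) !exprM (prim_expr_order w_prim) !expr1n invr1 mulr1 subrr.
Qed.

Lemma parseval (u : 'I_N -> C) :
  \sum_(a < N) rnorm (\sum_i u i * (w ^+ i) ^+ a) ^+ 2 =
  N%:R * \sum_i rnorm (u i) ^+ 2.
Proof.
apply: complexI; rewrite rmorphM rmorph_nat /= !rmorph_sum /=.
under eq_bigr => a _ do rewrite rnorm_sqr rmorph_sum /= mulr_suml.
rewrite exchange_big /= mulr_sumr; apply: eq_bigr => i _.
under eq_bigr => a _ do rewrite mulr_sumr.
rewrite exchange_big (bigD1 i) //= [X in _ + X]big1 ?addr0 => [|k ki].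
  under eq_bigr => a _ do rewrite rmorphM mulrACA.
  by rewrite -mulr_sumr root_orthogonality eqxx mulr1n mulrC -rnorm_sqr.
under eq_bigr => a _ do rewrite rmorphM mulrACA.
by rewrite -mulr_sumr root_orthogonality eq_sym (negbTE ki) mulr0n mulr0.
Qed.

End DiscreteFourier.

Section RootsOfUnityInDiscs.
Context {R : realType}.
Local Notation C := R[i].
Variables (m : nat) (w : C).
Local Notation N := m.+1.
Hypothesis w_prim : N.-primitive_root w.

Lemma same_truncn (x y : R) : 0 <= x -> 0 <= y ->
  Num.truncn x = Num.truncn y -> `|x - y| < 1.
Proof.
move=> x0 y0 xy.
have := truncn_itv x0; have := truncn_itv y0.
by rewrite xy -natr1 ltr_norml => /andP[? ?] /andP[? ?]; apply/andP; split; lra.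
Qed.

(** Division by a fixed element of [A] maps [A] injectively into the roots of unity
close to [1]. *)
Lemma card_roots_small_diameter (A : pred 'I_N) (d : R) :
  {in A &, forall i k : 'I_N, rnorm (w ^+ i - w ^+ k) < d} ->
  (#|A| <= #|[pred j : 'I_N | (rnorm (w ^+ j - 1) < d)%R]|)%N.
Proof.
move=> A_small; have [i0 Ai0|A0] := pickP A; last by rewrite eq_card0.
rewrite -(card_in_image (f := fun i => i - i0) (A := A)); last first.
  by move=> i k _ _; apply: addIr.
apply: subset_leq_card; apply/fintype.subsetP => j.
move=> /fintype.imageP[i Ai Ej]; rewrite {j}Ej inE.
rewrite -[ltLHS]mulr1 -(rnorm_rootX w_prim i0) -rnormM mulrBl mul1r -exprD.
rewrite -(prim_expr_mod w_prim) (_ : (_ %% N)%N = i) ?A_small //.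
by rewrite -[in RHS](subrK i0 i).
Qed.

(** A doubling property of the roots of unity, uniform in their number: the disc is
cut by an 8 by 8 grid into squares of side [d / 2], each of diameter less than
[d], so that [card_roots_small_diameter] applies to each square. *)
Lemma card_roots_disc (l : C) (d : R) : 0 < d ->
  (#|[pred i : 'I_N | (rnorm (w ^+ i - l) < 2 * d)%R]| <=
   64 * #|[pred j : 'I_N | (rnorm (w ^+ j - 1) < d)%R]|)%N.
Proof.
move=> d0; set A := [pred i : 'I_N | _]; set J := #|[pred j : 'I_N | _]|.
(* The grid coordinate maps the interval from -2d to 2d onto that from 0 to 8. *)
pose coord (x : R) := (x + 2 * d) * (2 / d).
have d1 : d / d = 1 by rewrite divff // gt_eqF.
have iV0 : 0 < d^-1 by rewrite invr_gt0.
have coord_itv x : `|x| < 2 * d -> 0 <= coord x < 8.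
  rewrite ltr_norml /coord => /andP[? ?]; apply/andP; split; nra.
pose cell (x : R) : 'I_8 := inord (Num.truncn (coord x)).
have cellP x y : `|x| < 2 * d -> `|y| < 2 * d -> cell x = cell y ->
    `|x - y| < d / 2.
  move=> /coord_itv/andP[x0 x8] /coord_itv/andP[y0 y8] /(congr1 val).
  have trunc8 z : 0 <= z -> z < 8 -> (Num.truncn z < 8)%N.
    by move=> z0 z8; rewrite truncn_lt_nat.
  rewrite /= !inordK ?trunc8 // => /same_truncn - /(_ x0 y0).
  rewrite /coord !ltr_norml => /andP[? ?]; apply/andP; split; nra.
pose cell2 (i : 'I_N) :=
  (cell (complex.Re (w ^+ i - l)), cell (complex.Im (w ^+ i - l))).
rewrite -sum1_card (partition_big cell2 predT) //=.
apply: (@leq_trans (\sum_(c : 'I_8 * 'I_8) J)%N); last first.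
  by rewrite sum_nat_const card_prod !card_ord.
apply: leq_sum => c _; rewrite sum1_card; apply: card_roots_small_diameter.
move=> i k /andP[Ai /eqP ci] /andP[Ak /eqP ck].
rewrite !inE in Ai Ak; have : cell2 i = cell2 k by rewrite ci ck.
have Re_lt x y :
    rnorm (w ^+ x - y) < 2 * d -> `|complex.Re (w ^+ x - y)| < 2 * d.
  exact: le_lt_trans (rnorm_Re _).
have Im_lt x y :
    rnorm (w ^+ x - y) < 2 * d -> `|complex.Im (w ^+ x - y)| < 2 * d.
  exact: le_lt_trans (rnorm_Im _).
case=> /cellP - /(_ (Re_lt _ _ Ai) (Re_lt _ _ Ak)) Hre.
move=> /cellP - /(_ (Im_lt _ _ Ai) (Im_lt _ _ Ak)) Him.
have -> : w ^+ i - w ^+ k = (w ^+ i - l) - (w ^+ k - l) by ring.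
apply: le_lt_trans (rnorm_ReIm _) _.
by move: Hre Him; rewrite !raddfB /=; lra.
Qed.

End RootsOfUnityInDiscs.

(** * The discrete Fejer kernel of a doubly power-bounded element *)

Section FejerKernel.
Context {R : realType} {B : banachAlgType R[i]}.
Local Notation C := R[i].

Lemma rnorm_banachM (x y : B) : rnorm (x * y) <= rnorm x * rnorm y.
Proof. by rewrite -lecR rmorphM /= -!rnormE ler_normM_banach. Qed.

Variables (b : B) (m : nat) (w : C).
Local Notation N := m.+1.
Hypothesis b_unit : b \is a GRing.unit.
Hypothesis w_prim : N.-primitive_root w.

Definition dirichlet (z : C) : B := \sum_(a < N) z ^- a *: b ^+ a.
(** The Dirichlet sum of [b^-1] at [z^-1]. *)
Definition dirichlet_inv (z : C) : B := \sum_(a < N) z ^+ a *: b ^- a.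
Definition fejer (z : C) : B :=
  N%:R ^- 2 *: (dirichlet z * dirichlet_inv z).

Lemma mul_dirichlet z : z != 0 -> z ^+ N = 1 ->
  (b - z%:A) * dirichlet z = z *: (b ^+ N - 1).
Proof.
move=> z0 zN.
have -> : dirichlet z = \sum_(a < N) (z^-1 *: b) ^+ a.
  by apply: eq_bigr => a _; rewrite exprZn exprVn.
have -> : b - z%:A = z *: (z^-1 *: b - 1).
  by rewrite scalerBr scalerA divff // scale1r.
by rewrite -scalerAl -subrX1 exprZn exprVn zN invr1 scale1r.
Qed.

Lemma mul_dirichlet_inv z : z ^+ N = 1 ->
  (b - z%:A) * dirichlet_inv z = b * (1 - b ^- N).
Proof.
move=> zN.
have -> : dirichlet_inv z = \sum_(a < N) (z *: b^-1) ^+ a.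
  by apply: eq_bigr => a _; rewrite exprZn exprVn.
have -> : b - z%:A = - (b * (z *: b^-1 - 1)).
  by rewrite mulrBr mulr1 opprB -scalerAr divrr.
by rewrite mulNr -mulrA -subrX1 exprZn exprVn zN scale1r -mulrN opprB.
Qed.

(** In the double sum over the exponents of [b] and [b^-1], averaging over the roots
of unity leaves the diagonal, where [b ^+ a * b ^- a = 1]. *)
Lemma sum_fejer v : v != 0 -> \sum_(i < N) fejer (w ^+ i * v) = 1.
Proof.
move=> v0; rewrite -scaler_sumr.
have wi0 i : w ^+ i != 0 by rewrite expf_neq0 // (prim_root_eq0 w_prim).
under eq_bigr => i _ do rewrite mulr_suml.
rewrite exchange_big /= (eq_bigr (fun=> N%:R *: 1)) => [|a _].
  rewrite sumr_const card_ord -(scaler_nat _ (_ *: _)) !scalerA -expr2.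
  by rewrite mulVf ?scale1r // expf_neq0 // pnatr_eq0.
under eq_bigr => i _ do rewrite mulr_sumr.
rewrite exchange_big (bigD1 a) //= [X in _ + X]big1 ?addr0 => [|c ca].
  rewrite (eq_bigr (fun=> 1)) => [|i _].
    by rewrite sumr_const card_ord scaler_nat.
  rewrite -scalerAl -scalerAr scalerA mulVf ?divrr ?scale1r ?unitrX //.
  by rewrite expf_neq0 // mulf_neq0.
have E (i : 'I_N) : (w ^+ i * v) ^- a *: b ^+ a * ((w ^+ i * v) ^+ c *: b ^- c) =
    ((w ^+ c) ^+ i * ((w ^+ a) ^+ i)^* * (v ^+ c / v ^+ a)) *:
    (b ^+ a * b ^- c).
  rewrite -scalerAl -scalerAr scalerA; congr (_ *: _).
  rewrite -!exprM (conj_root w_prim) !exprMn -!exprM !(mulnC i) invfM.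
  by rewrite mulrC !mulrA; ring.
rewrite (eq_bigr _ (fun i _ => E i)) -scaler_suml -mulr_suml.
by rewrite (root_orthogonality w_prim) (negbTE ca) mulr0n mul0r scale0r.
Qed.

Variable M : R.
Hypothesis b_bounded : forall k : int, rnorm (b ^ k) <= M.

Lemma power_bound_ge0 : 0 <= M.
Proof. exact: le_trans (rnorm_ge0 _) (b_bounded 0). Qed.

Lemma rnorm_expr k : rnorm (b ^+ k) <= M.
Proof. exact: (b_bounded k). Qed.

Lemma rnorm_exprV k : rnorm (b ^- k) <= M.
Proof. by have := b_bounded (- k%:Z); rewrite exprnN. Qed.

Lemma rnorm_mull_expr k (x : B) : rnorm (b ^+ k * x) <= M * rnorm x.
Proof.
by rewrite (le_trans (rnorm_banachM _ _)) // ler_wpM2r ?rnorm_ge0 ?rnorm_expr.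
Qed.

(** The coefficient of [b ^- a] in the sum is the product of the discrete Fourier
transforms of [u] and [v] at [a]; the product of two square-summable sequences
is summable, and Parseval's identity evaluates the sums of squares.  The bound
does not see how sharply [u] and [v] are cut off. *)
Lemma dirichlet_inv_product_bound (u v : 'I_N -> C) :
  rnorm (\sum_i \sum_j (u i * v j) *: dirichlet_inv (w ^+ i * w ^+ j)) <=
  M * N%:R / 2 * (\sum_i rnorm (u i) ^+ 2 + \sum_i rnorm (v i) ^+ 2).
Proof.
pose hat (f : 'I_N -> C) (a : 'I_N) := \sum_i f i * (w ^+ i) ^+ a.
have -> : \sum_i \sum_j (u i * v j) *: dirichlet_inv (w ^+ i * w ^+ j) =
    \sum_a (hat u a * hat v a) *: b ^- a.
  transitivity (\sum_(i < N) \sum_(a < N) \sum_(j < N)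
      ((u i * (w ^+ i) ^+ a) * (v j * (w ^+ j) ^+ a)) *: b ^- a).
    apply: eq_bigr => i _; rewrite exchange_big; apply: eq_bigr => j _ /=.
    rewrite scaler_sumr; apply: eq_bigr => a _.
    by rewrite scalerA exprMn mulrACA.
  rewrite exchange_big; apply: eq_bigr => a _ /=.
  rewrite mulr_suml scaler_suml; apply: eq_bigr => i _.
  by rewrite mulr_sumr scaler_suml.
apply: le_trans (rnorm_sum _ _ _) _.
apply: (@le_trans _ _
    (\sum_a M / 2 * (rnorm (hat u a) ^+ 2 + rnorm (hat v a) ^+ 2))).
  apply: ler_sum => a _; rewrite rnormZ rnormM mulrC.
  have M0 := power_bound_ge0; have bM := rnorm_exprV a.
  apply: (@le_trans _ _ (M * (rnorm (hat u a) * rnorm (hat v a)))).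
    by rewrite ler_wpM2r // mulr_ge0 ?rnorm_ge0.
  rewrite -mulrA ler_wpM2l //.
  have := sqr_ge0 (rnorm (hat u a) - rnorm (hat v a)); rewrite sqrrB; nra.
rewrite -mulr_sumr big_split /= !(parseval w_prim); lra.
Qed.

(** Expanding the factor [dirichlet] only twists [u] and [v] by unimodular
characters, so each of the [N] terms is controlled by
[dirichlet_inv_product_bound]. *)
Lemma fejer_product_bound (u v : 'I_N -> C) :
  rnorm (\sum_i \sum_j (u i * v j) *: fejer (w ^+ i * w ^+ j)) <=
  M ^+ 2 / 2 * (\sum_i rnorm (u i) ^+ 2 + \sum_i rnorm (v i) ^+ 2).
Proof.
set S := _ + _.
have -> : \sum_i \sum_j (u i * v j) *: fejer (w ^+ i * w ^+ j) =
    N%:R ^- 2 *: \sum_(a < N) b ^+ a * \sum_i \sum_j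
      ((u i * (w ^+ i) ^- a) * (v j * (w ^+ j) ^- a)) *:
        dirichlet_inv (w ^+ i * w ^+ j).
  under [in RHS]eq_bigr => a _ do rewrite mulr_sumr.
  rewrite [in RHS]exchange_big scaler_sumr; apply: eq_bigr => i _ /=.
  under [in RHS]eq_bigr => a _ do rewrite mulr_sumr.
  rewrite [in RHS]exchange_big scaler_sumr; apply: eq_bigr => j _ /=.
  rewrite /fejer scalerA [_ * N%:R ^- 2]mulrC -scalerA; congr (_ *: _).
  rewrite mulr_suml scaler_sumr; apply: eq_bigr => a _.
  by rewrite -scalerAl scalerA -scalerAr exprMn invfM mulrACA.
rewrite rnormZ rnormV rnormX rnorm_nat mulrC ler_pdivrMr ?exprn_gt0 //.
apply: le_trans (rnorm_sum _ _ _) _.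
apply: (@le_trans _ _ (\sum_(a < N) M * (M * N%:R / 2 * S))).
  apply: ler_sum => a _; apply: le_trans (rnorm_mull_expr _ _) _.
  rewrite ler_wpM2l ?power_bound_ge0 //.
  apply: le_trans (dirichlet_inv_product_bound _ _) _.
  have E (f : 'I_N -> C) i : rnorm (f i * (w ^+ i) ^- a) ^+ 2 = rnorm (f i) ^+ 2.
    by rewrite rnormM rnormV rnormX (rnorm_rootX w_prim) expr1n invr1 mulr1.
  by under eq_bigr do rewrite E; under [X in _ * (_ + X)]eq_bigr do rewrite E.
rewrite sumr_const card_ord -mulr_natl; lra.
Qed.

(** Multiplied by [b - z], the two geometric sums telescope to [b ^+ N - 1] and
[1 - b ^- N] up to bounded factors, and these stay bounded as [N] grows. *)
Lemma fejer_far (z : C) (r : R) (x : B) : z ^+ N = 1 -> rnorm z = 1 ->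
  x * (b - z%:A) = 1 -> rnorm x <= r ->
  rnorm (fejer z) <= 4 * r ^+ 2 * M ^+ 3 / N%:R ^+ 2.
Proof.
move=> zN z1 xbz xr.
have z0 : z != 0 by rewrite -rnorm_gt0 z1.
have r0 : 0 <= r by rewrite (le_trans (rnorm_ge0 _) xr).
have M0 := power_bound_ge0; have one_le : rnorm (1 : B) <= M := b_bounded 0.
have D_le : rnorm (dirichlet z) <= r * (2 * M).
  rewrite -[dirichlet z]mul1r -xbz -mulrA mul_dirichlet // -scalerAr rnormZ z1.
  rewrite mul1r (le_trans (rnorm_banachM _ _)) // ler_pM ?rnorm_ge0 //.
  have := rnormB (b ^+ N) 1; have := rnorm_expr N; lra.
have D'_le : rnorm (dirichlet_inv z) <= r * (M * (2 * M)).
  rewrite -[dirichlet_inv z]mul1r -xbz -mulrA mul_dirichlet_inv //.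
  rewrite (le_trans (rnorm_banachM _ _)) // ler_pM ?rnorm_ge0 //.
  rewrite (le_trans (rnorm_mull_expr 1 _)) // ler_wpM2l //.
  have := rnormB (1 : B) (b ^- N); have := rnorm_exprV N; lra.
rewrite rnormZ rnormV rnormX rnorm_nat mulrC ler_wpM2r ?invr_ge0 ?exprn_ge0 //.
rewrite (le_trans (rnorm_banachM _ _)) //.
have -> : 4 * r ^+ 2 * M ^+ 3 = r * (2 * M) * (r * (M * (2 * M))) by ring.
by rewrite ler_pM ?rnorm_ge0.
Qed.

End FejerKernel.

Section LocalizedEstimate.
Context {R : realType} {B : banachAlgType R[i]}.
Local Notation C := R[i].
Variables (b : B) (m : nat) (w : C).
Local Notation N := m.+1.
Hypothesis b_unit : b \is a GRing.unit.
Hypothesis w_prim : N.-primitive_root w.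
Variable M : R.
Hypothesis b_bounded : forall k : int, rnorm (b ^ k) <= M.

Lemma sum_sqr_le_card (A : pred 'I_N) (u : 'I_N -> C) :
  (forall i, rnorm (u i) <= (A i)%:R) -> \sum_i rnorm (u i) ^+ 2 <= #|A|%:R.
Proof.
move=> uA; rewrite -sum1_card natr_sum [leRHS]big_mkcond /=.
apply: ler_sum => i _.
have := uA i; have := rnorm_ge0 (u i); rewrite unfold_in.
by case: (A i) => /= ? ?; nra.
Qed.

(** The bound of [fejer_product_bound] is a sum of squares; rescaling [u] and [v]
beforehand makes it proportional to the product of their sup norms. *)
Lemma fejer_scaled_bound (A J : pred 'I_N) (s t : R) (u v : 'I_N -> C) :
  0 < s -> 0 < t ->
  (forall i, rnorm (u i) <= s * (A i)%:R) ->
  (forall j, rnorm (v j) <= t * (J j)%:R) ->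
  rnorm (\sum_i \sum_j (u i * v j) *: fejer b m (w ^+ i * w ^+ j)) <=
  s * t * M ^+ 2 / 2 * (#|A|%:R + #|J|%:R).
Proof.
move=> s0 t0 uA vJ.
have sC : s%:C%C != 0 by rewrite fmorph_eq0 gt_eqF.
have tC : t%:C%C != 0 by rewrite fmorph_eq0 gt_eqF.
pose u' i := u i / s%:C%C; pose v' j := v j / t%:C%C.
have -> : \sum_i \sum_j (u i * v j) *: fejer b m (w ^+ i * w ^+ j) =
    (s * t)%:C%C *: \sum_i \sum_j (u' i * v' j) *: fejer b m (w ^+ i * w ^+ j).
  rewrite scaler_sumr; apply: eq_bigr => i _.
  rewrite scaler_sumr; apply: eq_bigr => j _.
  rewrite scalerA rmorphM /=; congr (_ *: _); rewrite /u' /v'; field.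
  by rewrite sC tC.
have st0 : 0 <= s * t by rewrite mulr_ge0 // ltW.
rewrite rnormZ rnorm_real ger0_norm //.
set S := _ + _.
have -> : s * t * M ^+ 2 / 2 * S = s * t * (M ^+ 2 / 2 * S) by ring.
rewrite ler_wpM2l //.
apply: le_trans (fejer_product_bound w_prim b_bounded _ _) _.
rewrite ler_wpM2l ?divr_ge0 ?sqr_ge0 // lerD // sum_sqr_le_card // => i.
  by rewrite rnormM rnormV rnorm_real gtr0_norm // ler_pdivrMr // mulrC.
by rewrite rnormM rnormV rnorm_real gtr0_norm // ler_pdivrMr // mulrC.
Qed.

(** The kernel summed over the products of a root in [A] by a root in [J]: up to the
factor [#|J|], the mass over [A] smoothed by averaging over translates by [J]. *)
Definition fejer_mass (A J : pred 'I_N) : B :=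
  \sum_i \sum_j ((A i)%:R * (J j)%:R) *: fejer b m (w ^+ i * w ^+ j).

(** With [z = w ^+ i * w ^+ j], the factor [b - l] is split as
[(b - z) + (w ^+ i - l) * w ^+ j + l * (w ^+ j - 1)].  The first term telescopes
a Dirichlet sum and gains [1 / N]; the other two are small on [A] and [J], and
are products of a function of [i] by a function of [j], as the convolution
bounds require. *)
Lemma fejer_mass_near (l : C) (d : R) (A J : pred 'I_N) :
  rnorm l = 1 -> 0 < d ->
  (forall i, A i -> rnorm (w ^+ i - l) <= 2 * d) ->
  (forall j, J j -> rnorm (w ^+ j - 1) <= d) ->
  rnorm ((b - l%:A) * fejer_mass A J) <=
  (M ^+ 2 / N%:R + 2 * d * M ^+ 2) * (#|A|%:R + #|J|%:R).
Proof.
move=> l1 d0 Ad Jd; set S : R := #|A|%:R + #|J|%:R.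
have S0 : 0 <= S by rewrite addr_ge0.
have M0 := power_bound_ge0 b_bounded.
have w1 := rnorm_rootX w_prim.
pose T1 := \sum_(i < N) \sum_(j < N)
  ((w ^+ i * (A i)%:R) * (w ^+ j * (J j)%:R)) *: dirichlet_inv b m (w ^+ i * w ^+ j).
pose T2 := \sum_(i < N) \sum_(j < N)
  (((w ^+ i - l) * (A i)%:R) * (w ^+ j * (J j)%:R)) *: fejer b m (w ^+ i * w ^+ j).
pose T3 := \sum_(i < N) \sum_(j < N) ((A i)%:R * ((w ^+ j - 1) * (J j)%:R)) *:
  fejer b m (w ^+ i * w ^+ j).
have -> : (b - l%:A) * fejer_mass A J =
    N%:R ^- 2 *: ((b ^+ N - 1) * T1) + T2 + l *: T3.
  rewrite !mulr_sumr !scaler_sumr -!big_split; apply: eq_bigr => i _ /=.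
  rewrite !mulr_sumr !scaler_sumr -!big_split; apply: eq_bigr => j _ /=.
  set z := w ^+ i * w ^+ j.
  have z0 : z != 0 by rewrite mulf_neq0 // -rnorm_gt0 w1.
  have zN : z ^+ N = 1 by exact: root_mul_exprN w_prim i j.
  have bz : (b - z%:A) * fejer b m z =
      N%:R ^- 2 *: (z *: ((b ^+ N - 1) * dirichlet_inv b m z)).
    by rewrite -scalerAr mulrA mul_dirichlet // -scalerAl.
  have bl : (b - l%:A) * fejer b m z =
      N%:R ^- 2 *: (z *: ((b ^+ N - 1) * dirichlet_inv b m z)) +
      (z - l) *: fejer b m z.
    by rewrite -bz -(mulr_algl (z - l) (fejer b m z)) -mulrDl scalerBl addrA subrK.
  rewrite -(scalerAr ((A i)%:R * _)) bl -(scalerAr (_ * (w ^+ j * _))).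
  rewrite !scalerDr !scalerA -addrA -scalerDl.
  by congr (_ *: _ + _ *: _); rewrite /z; ring.
have T1_le : rnorm T1 <= M * N%:R / 2 * S.
  apply: le_trans (dirichlet_inv_product_bound w_prim b_bounded _ _) _.
  rewrite ler_wpM2l ?divr_ge0 ?mulr_ge0 // lerD // sum_sqr_le_card // => i;
    by rewrite rnormM w1 mul1r rnorm_nat.
pose e := d * M ^+ 2 * S; have e0 : 0 <= e by rewrite !mulr_ge0 ?sqr_ge0 // ltW.
have T2_le : rnorm T2 <= e.
  rewrite (_ : e = 2 * d * 1 * M ^+ 2 / 2 * S); last by rewrite /e; field.
  apply: fejer_scaled_bound => //; first lra.
    move=> i; rewrite rnormM rnorm_nat.
    by case: (boolP (A i)) => [/Ad|]; rewrite ?mulr1 ?mulr0.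
  by move=> j; rewrite rnormM w1 rnorm_nat.
have T3_le : rnorm T3 <= e / 2.
  rewrite (_ : e / 2 = 1 * d * M ^+ 2 / 2 * S); last by rewrite /e; field.
  apply: fejer_scaled_bound => //; first by move=> i; rewrite rnorm_nat mul1r.
  move=> i; rewrite rnormM rnorm_nat.
  by case: (boolP (J i)) => [/Jd|]; rewrite ?mulr1 ?mulr0.
apply: le_trans (rnormD _ _) _; apply: le_trans (lerD (rnormD _ _) (lexx _)) _.
rewrite !rnormZ l1 mul1r rnormV rnormX rnorm_nat.
have N0 : 0 < N%:R :> R by rewrite ltr0n.
have bN : rnorm (b ^+ N - 1) <= 2 * M.
  have := rnormB (b ^+ N) 1; have := rnorm_expr b_bounded N; have := b_bounded 0.
  by rewrite expr0z; lra.
have : (N%:R ^+ 2)^-1 * rnorm ((b ^+ N - 1) * T1) <= M ^+ 2 / N%:R * S.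
  apply: (@le_trans _ _ ((N%:R ^+ 2)^-1 * (2 * M * (M * N%:R / 2 * S)))).
    rewrite ler_wpM2l ?invr_ge0 ?exprn_ge0 //.
    by rewrite (le_trans (rnorm_banachM _ _)) // ler_pM ?rnorm_ge0.
  by rewrite le_eqVlt; apply/orP; left; apply/eqP; field; rewrite gt_eqF.
have -> : (M ^+ 2 / N%:R + 2 * d * M ^+ 2) * S = M ^+ 2 / N%:R * S + 2 * e.
  by rewrite /e; ring.
move: (_ ^- 2 * _) (_ / N%:R * S) (rnorm T2) (rnorm T3) T2_le T3_le.
by move: e e0 => e e0 x y t2 t3; lra.
Qed.

Lemma fejer_mass_far (r : R) (A J : pred 'I_N) :
  (forall i j, A i -> J j ->
    exists2 x : B, x * (b - (w ^+ i * w ^+ j)%:A) = 1 & rnorm x <= r) ->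
  rnorm (fejer_mass A J) <= 4 * r ^+ 2 * M ^+ 3 / N%:R * #|J|%:R.
Proof.
move=> far; have M0 := power_bound_ge0 b_bounded.
have w1 := rnorm_rootX w_prim.
set e := 4 * r ^+ 2 * M ^+ 3 / N%:R ^+ 2.
have e0 : 0 <= e.
  by rewrite divr_ge0 ?sqr_ge0 // mulr_ge0 ?exprn_ge0 // mulr_ge0 ?sqr_ge0.
apply: (@le_trans _ _ (\sum_(i < N) \sum_(j < N | J j) e)); last first.
  rewrite !sumr_const card_ord -mulrnA -[e *+ _]mulr_natr natrM /e le_eqVlt.
  by apply/orP; left; apply/eqP; field.
apply: le_trans (rnorm_sum _ _ _) _; apply: ler_sum => i _.
apply: le_trans (rnorm_sum _ _ _) _; rewrite [leRHS]big_mkcond /=.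
apply: ler_sum => j _; rewrite rnormZ rnormM !rnorm_nat.
case: (boolP (J j)) => [Jj|]; last by rewrite mulr0 mul0r.
case: (boolP (A i)) => [Ai|]; last by rewrite !mul0r.
rewrite !mul1r; have [x xb xr] := far i j Ai Jj.
apply: (fejer_far b_unit b_bounded _ _ xb xr).
  exact: root_mul_exprN w_prim i j.
by rewrite rnormM !w1 mulr1.
Qed.

(** Here [J] is the arc of radius [d] about [1], and every root of unity is either
attached to one [l k] at distance less than [2 * d], or at distance at least
[2 * d] from all of them; in the second case its translates by [J] stay at
distance at least [d].  The constant 65 is [64 + 1], with 64 from
[card_roots_disc]. *)
Lemma fejer_annihilator_bound (n : nat) (l : 'I_n -> C) (d r : R)
    (q : B) (q' : 'I_n -> B) :
  (forall k, rnorm (l k) = 1) -> 0 < d ->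
  (forall k, q = q' k * (b - (l k)%:A)) ->
  (forall z : C, rnorm z = 1 -> (forall k, d <= rnorm (z - l k)) ->
    exists2 x : B, x * (b - z%:A) = 1 & rnorm x <= r) ->
  rnorm q <= rnorm q * (4 * r ^+ 2 * M ^+ 3 / N%:R) +
    \sum_k rnorm (q' k) * (65 * (M ^+ 2 / N%:R + 2 * d * M ^+ 2)).
Proof.
move=> l1 d0 qE resolvent_bound.
have M0 := power_bound_ge0 b_bounded; have w1 := rnorm_rootX w_prim.
pose J := [pred j : 'I_N | rnorm (w ^+ j - 1) < d].
pose c (i : 'I_N) := [pick k | rnorm (w ^+ i - l k) < 2 * d].
pose near_pt k := [pred i | c i == Some k]; pose far := [pred i | c i == None].
have J0 : 0 < #|J|%:R :> R.
  by rewrite ltr0n; apply/card_gt0P; exists ord0; rewrite inE subrr rnorm0.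
have sumJ : #|J|%:R *: 1 = fejer_mass far J + \sum_k fejer_mass (near_pt k) J.
  rewrite exchange_big -big_split /=.
  transitivity (\sum_(i < N) \sum_j (J j)%:R *: fejer b m (w ^+ i * w ^+ j)).
    rewrite exchange_big /=.
    under eq_bigr => j _.
      rewrite -scaler_sumr (sum_fejer b_unit w_prim) ?over //.
      by rewrite -rnorm_gt0 w1.
    by rewrite -scaler_suml -natr_sum -big_mkcond sum1_card.
  apply: eq_bigr => i _; rewrite exchange_big -big_split /=.
  apply: eq_bigr => j _; rewrite -scaler_suml -scalerDl -mulr_suml -mulrDl.
  rewrite -natr_sum -natrD (_ : (_ + _)%N = 1%N) ?mul1r //.
  case: (c i) => [k|]; last by rewrite eqxx big1.
  rewrite (bigD1 k) //= eqxx big1 // => k' /negbTE kk'.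
  by rewrite -[LHS]/((Some k == Some k') : nat) eq_sym [_ == _]kk'.
rewrite -(ler_pM2r J0).
have -> : rnorm q * #|J|%:R = rnorm (q * (#|J|%:R *: 1)).
  by rewrite -scalerAr mulr1 rnormZ rnorm_nat mulrC.
rewrite sumJ mulrDr mulrDl; apply: le_trans (rnormD _ _) _.
apply: lerD.
  apply: le_trans (rnorm_banachM _ _) _; rewrite -[leRHS]mulrA ler_wpM2l ?rnorm_ge0 //.
  apply: fejer_mass_far => i j /= far_i Jj; apply: resolvent_bound.
    by rewrite rnormM !w1 mulr1.
  move=> k; move: far_i; rewrite /c; case: pickP => // /(_ k) /negbT.
  rewrite -leNgt => far_k _.
  have : rnorm (w ^+ i * (w ^+ j - 1)) < d by rewrite rnormM w1 mul1r.
  rewrite (_ : w ^+ i * (w ^+ j - 1) =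
      - ((w ^+ i - l k) - (w ^+ i * w ^+ j - l k))).
    rewrite rnormN.
    by have := ler_rnorm_dist (w ^+ i - l k) (w ^+ i * w ^+ j - l k); lra.
  by ring.
rewrite mulr_sumr mulr_suml; apply: le_trans (rnorm_sum _ _ _) _.
apply: ler_sum => k _.
rewrite {1}(qE k) -mulrA -[leRHS]mulrA.
apply: le_trans (rnorm_banachM _ _) _; rewrite ler_wpM2l ?rnorm_ge0 //.
apply: le_trans (fejer_mass_near (l1 k) d0 _ _) _.
- move=> i /=; rewrite /c; case: pickP => // k' /ltW near_k' /eqP[<-] //.
- by move=> j /= /ltW.
rewrite (mulrC 65) -[leRHS]mulrA ler_wpM2l //.
  by rewrite addr_ge0 // ?divr_ge0 ?mulr_ge0 ?sqr_ge0 // ltW.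
rewrite -natrM -natrD ler_nat mulSn addnC leq_add2l.
apply: leq_trans (card_roots_disc w_prim (l k) d0).
apply/subset_leq_card/fintype.subsetP => i; rewrite !inE /c.
by case: pickP => // k' near_k' /eqP[<-].
Qed.

End LocalizedEstimate.

(** * The unit circle *)

Section UnitCircle.
Context {R : realType}.
Local Notation C := R[i].

Definition expi (t : R) : C := (cos (2 * pi * t) +i* sin (2 * pi * t))%C.

Lemma expiD s t : expi (s + t) = expi s * expi t.
Proof.
rewrite /expi mulrDr cosD sinD addrC [in RHS]mulrC; simpc.
by congr (_ +i* _)%C; ring.
Qed.

Lemma expi0 : expi 0 = 1.
Proof. by rewrite /expi mulr0 cos0 sin0. Qed.

Lemma expi1 : expi 1 = 1.
Proof. by rewrite /expi mulr1 mulr_natl cos2pi sin2pi. Qed.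

Lemma rnorm_expi t : rnorm (expi t) = 1.
Proof. by rewrite /rnorm normc_def /= cos2Dsin2 sqrtr1. Qed.

Lemma expi_neq0 t : expi t != 0.
Proof. by rewrite -rnorm_gt0 rnorm_expi. Qed.

Lemma expiN t : expi (- t) = (expi t)^-1.
Proof.
by apply: (mulfI (expi_neq0 t)); rewrite -expiD subrr expi0 divff // expi_neq0.
Qed.

Lemma expiMn t k : expi (t * k%:R) = expi t ^+ k.
Proof.
elim: k => [|k IH]; first by rewrite mulr0 expi0.
by rewrite -addn1 natrD mulrDr mulr1 expiD IH addn1 exprSr.
Qed.

Lemma expi_eq1 t : 0 <= t < 1 -> expi t = 1 -> t = 0.
Proof.
move=> /andP[t0 t1] [ct st]; have p0 := pi_gt0 R.
have [t2|t2] := leP t 2^-1.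
  suff : 2 * pi * t = 0 by move/eqP; rewrite !mulf_eq0 gt_eqF // (gt_eqF p0) => /eqP.
  apply: cos_inj; rewrite ?in_itv /= ?cos0 ?lexx ?pi_ge0 //.
  by apply/andP; split; nra.
have : 0 < sin (2 * pi * t - pi) by apply: sin_gt0_pi; apply/andP; split; nra.
by rewrite sinB cospi sinpi st mul0r mulr0 subrr ltxx.
Qed.

Lemma expi_inj : {in `[0, 1[ &, injective expi}.
Proof.
move=> s t; rewrite !in_itv /= => s01 t01 est.
wlog st : s t s01 t01 est / s <= t.
  move=> H; have [/H|/ltW /H] := leP s t; first exact.
  by move=> /(_ t01 s01 (esym est)).
have ts0 : t - s = 0.
  apply: expi_eq1; last by rewrite expiD expiN est divff // expi_neq0.
  by move: s01 t01 => /andP[? ?] /andP[? ?]; apply/andP; split; lra.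
lra.
Qed.

Lemma expi_surj (z : C) : rnorm z = 1 -> exists2 t, 0 <= t < 1 & z = expi t.
Proof.
move=> z1; have p0 := pi_gt0 R.
have xy1 : complex.Re z ^+ 2 + complex.Im z ^+ 2 = 1.
  by apply: complexI; rewrite add_Re2_Im2 rnormE z1 expr1n.
have x1 : -1 <= complex.Re z <= 1.
  by apply/andP; split; have := sqr_ge0 (complex.Im z); nra.
pose a := acos (complex.Re z).
have a0 : 0 <= a by exact: acos_ge0.
have api : a <= pi by exact: acos_lepi.
have ca : cos a = complex.Re z by rewrite acosK // in_itv.
have sa : sin a = `|complex.Im z|.
  by rewrite sin_acos // -sqrtr_sqr; congr Num.sqrt; lra.
have [y0|y0] := leP 0 (complex.Im z).
  exists (a / (2 * pi)).
    by apply/andP; split; rewrite ?divr_ge0 ?ltr_pdivrMr //; lra.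
  rewrite /expi mulrC divfK; last by rewrite mulf_neq0 // gt_eqF.
  by rewrite ca sa ger0_norm //; case: (z).
have a_gt0 : 0 < a.
  rewrite lt_def a0 andbT; apply/eqP => a00.
  by move: sa; rewrite a00 sin0 => /esym/eqP; rewrite normr_eq0 lt_eqF.
(* In the lower half plane the angle is minus the arc cosine, and is shifted
   by one turn to fall into the parameter interval. *)
exists (1 - a / (2 * pi)).
  have : 0 < a / (2 * pi) by rewrite divr_gt0 // mulr_gt0.
  have : a / (2 * pi) <= 1 by rewrite ler_pdivrMr ?mulr_gt0 //; lra.
  by move=> ? ?; apply/andP; split; lra.
rewrite expiD expi1 mul1r expiN.
have -> : expi (a / (2 * pi)) = (complex.Re z -i* complex.Im z)%C.
  rewrite /expi mulrC divfK; last by rewrite mulf_neq0 // gt_eqF.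
  by rewrite ca sa ltr0_norm.
apply: (mulIf (x := (complex.Re z -i* complex.Im z)%C)).
  apply: contraTneq y0 => -[_ /eqP]; rewrite oppr_eq0 => /eqP ->.
  by rewrite ltxx.
rewrite mulVf; last first.
  apply: contraTneq y0 => -[_ /eqP]; rewrite oppr_eq0 => /eqP ->.
  by rewrite ltxx.
by case: (z) xy1 => x y /= xy1; simpc; congr (_ +i* _)%C; nra.
Qed.

Lemma expi_prim_root m : m.+1.-primitive_root (expi m.+1%:R^-1).
Proof.
rewrite /primitive_root_of_unity /=; apply/forallP => i; apply/eqP.
rewrite unity_rootE -expiMn mulrC; have N0 : 0 < m.+1%:R :> R by rewrite ltr0n.
have [im|im] := eqVneq i.+1 m.+1.
  by rewrite im divff ?(gt_eqF N0) // expi1 !eqxx.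
apply/negbTE/eqP => /expi_eq1 H.
have {}H : i.+1%:R / m.+1%:R = 0 :> R.
  apply: H; rewrite divr_ge0 // ltr_pdivrMr // mul1r ltr_nat ltnS.
  by rewrite ltn_neqAle -eqSS im /= -ltnS.
by move/eqP: H; rewrite mulf_eq0 invr_eq0 !pnatr_eq0.
Qed.

End UnitCircle.

Section ExpiLipschitz.
Context {R : realType}.
Local Notation C := R[i].

Lemma derive_bound (f df : R -> R) (K : R) (x y : R) :
  (forall t : R, is_derive t 1 f (df t)) ->
  (forall t : R, `|t - x| <= `|y - x| -> `|df t| <= K) ->
  `|f y - f x| <= K * `|y - x|.
Proof.
move=> fd dfK.
have fc a b : {within `[a, b], continuous f}.
  apply: derivable_within_continuous => t _; exact: ex_derive.
have [xy|yx|->] := ltgtP x y; last by rewrite !subrr normr0 mulr0.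
- have [c] := MVT xy (fun t _ => fd t) (fc x y).
  rewrite in_itv /= => /andP[xc cy] ->; rewrite normrM ler_wpM2r // dfK //.
  by rewrite !ger0_norm ?subr_ge0 ?(ltW xc, ltW xy) // lerD2r ltW.
- have [c] := MVT yx (fun t _ => fd t) (fc y x).
  rewrite in_itv /= => /andP[yc cx].
  rewrite -normrN opprB => ->; rewrite normrM [`|y - x|]distrC ler_wpM2r // dfK //.
  rewrite -normrN opprB [`|y - x|]distrC !ger0_norm ?subr_ge0 ?(ltW cx, ltW yx) //.
  by rewrite lerB // ltW.
Qed.

Lemma sin_lipschitz (x y : R) : `|sin y - sin x| <= `|y - x|.
Proof.
rewrite -[leRHS]mul1r; apply: derive_bound => t _; exact: cos_max.
Qed.

Lemma cos_lipschitz (x y : R) : `|cos y - cos x| <= `|y - x|.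
Proof.
rewrite -[leRHS]mul1r; apply: derive_bound => t _; rewrite normrN; exact: sin_max.
Qed.

Lemma cos_sub1_bound (x : R) : `|cos x - 1| <= x ^+ 2.
Proof.
have := @derive_bound cos (fun t => - sin t) `|x| 0 x _ _.
rewrite cos0 subr0 -normrM -expr2 ger0_norm ?sqr_ge0 //; apply => t.
rewrite !subr0 normrN; apply: le_trans.
by have := sin_lipschitz 0 t; rewrite sin0 !subr0.
Qed.

Lemma sin_sub_bound (x : R) : `|sin x - x| <= x ^+ 2.
Proof.
have := @derive_bound (fun t => sin t - t) (fun t => cos t - 1) `|x| 0 x _ _.
rewrite sin0 !subr0 -normrM -expr2 ger0_norm ?sqr_ge0 //; apply => t.
rewrite subr0; apply: le_trans.
by have := cos_lipschitz 0 t; rewrite cos0 subr0.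
Qed.

Lemma expi_linearization (t : R) :
  rnorm (expi t - 1 - two_pi_i * t%:C%C) <= 2 * (2 * pi) ^+ 2 * t ^+ 2.
Proof.
rewrite /expi /two_pi_i; simpc; apply: le_trans (rnorm_ReIm _) _ => /=.
have := cos_sub1_bound (2 * pi * t); have := sin_sub_bound (2 * pi * t).
rewrite !exprMn; lra.
Qed.

Lemma expi_lipschitz (s t : R) : rnorm (expi s - expi t) <= 4 * pi * `|s - t|.
Proof.
rewrite /expi; simpc; apply: le_trans (rnorm_ReIm _) _ => /=.
have := cos_lipschitz (2 * pi * t) (2 * pi * s).
have := sin_lipschitz (2 * pi * t) (2 * pi * s).
rewrite -mulrBr normrM ger0_norm; last by rewrite mulr_ge0 // pi_ge0.
lra.
Qed.

End ExpiLipschitz.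

(** * Neumann series and resolvents *)

Section Neumann.
Context {R : realType} {B : banachAlgType R[i]}.
Local Notation C := R[i].

Lemma expr_lt_eps (s e : R) : 0 <= s < 1 -> 0 < e ->
  exists n0, forall k, (n0 <= k)%N -> s ^+ k < e.
Proof.
move=> /andP[s0 s1] e0.
have /cvgrPdist_lt /(_ e e0) [n0 _ H] : (GRing.exp s : nat -> R) @ \oo --> 0.
  by apply: cvg_expr; rewrite ger0_norm.
exists n0 => k /H; rewrite sub0r normrN ger0_norm //; exact: exprn_ge0.
Qed.

Lemma rnorm_cauchy_cvg (V : completeNormedModType C) (u : nat -> V) :
  (forall e : R, 0 < e -> exists n0, forall k, (n0 <= k)%N ->
     rnorm (u n0 - u k) < e) ->
  exists y, forall e : R, 0 < e -> exists n0, forall k, (n0 <= k)%N ->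
     rnorm (y - u k) < e.
Proof.
have posE (e : C) : 0 < e -> e = (complex.Re e)%:C%C /\ 0 < complex.Re e.
  by move=> e0; rewrite -ltcR RRe_real // gtr0_real.
move=> u_cauchy; have : cauchy (u @ \oo).
  apply: cauchy_exP => e /posE[-> /u_cauchy[n0 n0P]].
  exists (u n0), n0 => // k /n0P H.
  by rewrite -ball_normE /ball_ /= rnorm_lt.
move=> /cauchy_cvgP/cvg_ex[y /cvgrPdist_lt uy]; exists y => e e0.
have /uy[n0 _ H] : 0 < e%:C%C :> C by rewrite ltcR.
by exists n0 => k /H; rewrite rnorm_lt.
Qed.

Lemma neumann_unit (x : B) (M s : R) : 0 <= s < 1 ->
  (forall k, rnorm (x ^+ k) <= M * s ^+ k) -> 1 - x \is a GRing.unit.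
Proof.
move=> s01 xk; have /andP[s0 s1] := s01.
have M0 : 0 <= M.
  by have := xk 0; rewrite expr0 mulr1; apply: le_trans; exact: rnorm_ge0.
pose u n := \sum_(k < n) x ^+ k.
have tail p k : (p <= k)%N -> rnorm (u p - u k) <= M / (1 - s) * s ^+ p.
  move=> pk; rewrite rnorm_distC.
  have -> : u k - u p = \sum_(p <= i < k) x ^+ i.
    rewrite /u -!(big_mkord predT (fun i => x ^+ i)) (big_cat_nat (n := p)) //=.
    by rewrite addrAC subrr add0r.
  apply: le_trans (rnorm_sum _ _ _) _.
  apply: (@le_trans _ _ (\sum_(p <= i < k) M * s ^+ i)); first exact: ler_sum.
  rewrite -mulr_sumr -mulrA ler_wpM2l // mulrC ler_pdivlMr ?subr_gt0 //.
  have -> : (\sum_(p <= i < k) s ^+ i) * (1 - s) = s ^+ p - s ^+ k.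
    rewrite mulr_suml (eq_bigr (fun i => - (s ^+ i.+1 - s ^+ i))); last first.
      by move=> i _; rewrite exprS; ring.
    by rewrite sumrN telescope_sumr // opprB.
  by rewrite gerBl exprn_ge0.
have c0 : 0 <= M / (1 - s) by rewrite divr_ge0 // subr_ge0 ltW.
have scaled (c e : R) : 0 <= c -> 0 < e ->
    exists n0, forall k, (n0 <= k)%N -> c * s ^+ k < e.
  move=> c_ge0 e0; have [|n0 H] := expr_lt_eps (e := e / (c + 1)) s01.
    by rewrite divr_gt0 // ltr_wpDl.
  exists n0 => k /H; rewrite ltr_pdivlMr ?ltr_wpDl //; apply: le_lt_trans.
  by rewrite mulrC ler_wpM2l ?exprn_ge0 // lerDl.
have [y uy] : exists y, forall e : R, 0 < e ->
    exists n0, forall k, (n0 <= k)%N -> rnorm (y - u k) < e.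
  apply: rnorm_cauchy_cvg => e /(scaled _ _ c0)[n0 H]; exists n0 => k nk.
  by apply: le_lt_trans (tail _ _ nk) (H _ _).
have lim0 (z : B) :
    (forall k, rnorm z <= rnorm (1 - x) * rnorm (y - u k) + rnorm (x ^+ k)) ->
    z = 0.
  move=> zk; apply/eqP; rewrite -rnorm_eq0 eq_le rnorm_ge0 andbT.
  apply/ler_addgt0Pr => e e0; rewrite add0r.
  have c1 : 0 < rnorm (1 - x) + 1 by rewrite ltr_wpDl // rnorm_ge0.
  have [|n1 H1] := uy (e / 2 / (rnorm (1 - x) + 1)); first by rewrite !divr_gt0.
  have [|n2 H2] := scaled M (e / 2) M0; first by rewrite divr_gt0.
  have k1 : (n1 <= n1 + n2)%N by rewrite leq_addr.
  have := H2 _ (leq_addl n1 n2); have := xk (n1 + n2)%N; have := zk (n1 + n2)%N.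
  have := H1 _ k1; rewrite ltr_pdivlMr //; have := rnorm_ge0 (y - u (n1 + n2)%N).
  have := rnorm_ge0 (1 - x); nra.
have xu k : (1 - x) * u k = 1 - x ^+ k.
  by rewrite -[LHS]opprK -mulNr opprB -subrX1 opprB.
have ux k : u k * (1 - x) = 1 - x ^+ k.
  rewrite -xu /u mulr_suml mulr_sumr; apply: eq_bigr => i _.
  by rewrite mulrBr mulrBl mulr1 mul1r -exprS -exprSr.
apply/unitrP; exists y; split; apply/eqP; rewrite -subr_eq0; apply/eqP.
  apply: lim0 => k; have -> : y * (1 - x) - 1 = (y - u k) * (1 - x) - x ^+ k.
    by rewrite mulrBl ux -addrA -opprD subrK.
  apply: le_trans (rnormB _ _) _; rewrite lerD2r mulrC.
  exact: rnorm_banachM.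
apply: lim0 => k; have -> : (1 - x) * y - 1 = (1 - x) * (y - u k) - x ^+ k.
  by rewrite mulrBr xu -addrA -opprD subrK.
apply: le_trans (rnormB _ _) _; rewrite lerD2r.
exact: rnorm_banachM.
Qed.

(** The bound on the powers makes the Neumann series of [1 - b / l] geometric. *)
Lemma spectrum_le1 (b : B) (M : R) (l : C) :
  (forall k, rnorm (b ^+ k) <= M) -> spectrum b l -> rnorm l <= 1.
Proof.
move=> bM /negP; rewrite leNgt => bl; apply/negP => l1; apply: bl.
have l0 : l != 0 by rewrite -rnorm_gt0 (lt_trans _ l1).
have -> : b - l%:A = (- l)%:A * (1 - l^-1 *: b).
  by rewrite mulr_algl scaleNr scalerBr scalerA divff // scale1r opprB.
rewrite unitrMr ?scaler_unit ?unitr1 ?unitfE ?oppr_eq0 //.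
apply: (@neumann_unit _ M (rnorm l)^-1).
  by rewrite invr_ge0 rnorm_ge0 invf_lt1 // (lt_trans _ l1).
move=> k; rewrite exprZn rnormZ rnormX rnormV mulrC ler_wpM2r //.
by rewrite exprn_ge0 // invr_ge0 rnorm_ge0.
Qed.

Lemma spectrumV (b : B) (l : C) : b \is a GRing.unit ->
  spectrum b l -> spectrum b^-1 l^-1.
Proof.
move=> ub; rewrite /spectrum /= => /negP bl; apply/negP => bl'; apply: bl.
have [l0|l0] := eqVneq l 0; first by rewrite l0 scale0r subr0.
have -> : b - l%:A = (- l)%:A * b * (b^-1 - l^-1%:A).
  rewrite mulr_algl -scalerAl mulrBr divrr // -scalerAr mulr1 scalerBr scalerA.
  by rewrite mulNr divff // scaleNr scaleN1r opprK addrC.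
by rewrite !unitrMl // scaler_unit ?unitr1 // unitfE oppr_eq0.
Qed.

End Neumann.

Section ResolventBound.
Context {R : realType} {B : banachAlgType R[i]}.
Local Notation C := R[i].

(** By the resolvent identity [x' = x + (z' - z) x' x], which absorbs half of the
norm of [x'] into the left-hand side when [z'] is close to [z]. *)
Lemma resolvent_locally_bounded (b : B) (z : C) : b - z%:A \is a GRing.unit ->
  exists2 e : R, 0 < e & exists r : R, forall z', rnorm (z - z') < e ->
    b - z'%:A \is a GRing.unit -> rnorm (b - z'%:A)^-1 <= r.
Proof.
move=> uz; set x := (b - z%:A)^-1.
have c0 : 0 < 2 * (rnorm x + 1) by rewrite mulr_gt0 // ltr_wpDl ?rnorm_ge0.
exists (2 * (rnorm x + 1))^-1; first by rewrite invr_gt0.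
exists (2 * rnorm x) => z' zz' uz'; set x' := (b - z'%:A)^-1.
have E : x' = x + (z' - z) *: (x' * x).
  have D : (b - z%:A) - (b - z'%:A) = (z' - z)%:A.
    by rewrite opprB addrC addrA subrK -scalerBl.
  rewrite scalerAl -[X in X * x]mulr1 -scalerAl scalerAr -D mulrBr mulVr //.
  by rewrite mulrBl mul1r -mulrA divrr // mulr1 addrC subrK.
have : rnorm x' <= rnorm x + rnorm (z - z') * (rnorm x' * rnorm x).
  rewrite {1}E (le_trans (rnormD _ _)) // lerD2l rnormZ rnorm_distC.
  by rewrite ler_wpM2l ?rnorm_ge0 ?rnorm_banachM.
move: zz'; rewrite -[ltRHS]mul1r ltr_pdivlMr //.
have := rnorm_ge0 x; have := rnorm_ge0 x'; have := rnorm_ge0 (z - z').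
move: (rnorm x) (rnorm x') (rnorm (z - z')) => p q t t0 q0 p0 H1 H2.
have : t * p <= 1 / 2 by nra.
nra.
Qed.

(** The circle minus the open discs of radius [d] is covered by neighbourhoods on
which the resolvent is bounded; compactness is that of the parameter
interval. *)
Lemma resolvent_bound_off_points (n : nat) (b : B) (l : 'I_n -> C) (d : R) :
  0 < d ->
  (forall z, rnorm z = 1 -> (forall k, z != l k) -> b - z%:A \is a GRing.unit) ->
  exists r : R, forall z, rnorm z = 1 -> (forall k, d <= rnorm (z - l k)) ->
    rnorm (b - z%:A)^-1 <= r.
Proof.
move=> d0 b_unit.
have near_expi (t e : R) : 0 < e -> \forall s \near t, rnorm (expi t - expi s) < e.
  move=> e0; have p0 : 0 < 4 * (pi : R) by rewrite mulr_gt0 // pi_gt0.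
  apply/nbhs_ballP; exists (e / (4 * (pi : R))); rewrite /= ?divr_gt0 // => s.
  rewrite /ball /= ltr_pdivlMr // mulrC; apply: le_lt_trans; exact: expi_lipschitz.
pose good (r t : R) := (forall k, d <= rnorm (expi t - l k)) ->
  rnorm (b - (expi t)%:A)^-1 <= r.
have /compact_near_coveringP cover := @segment_compact R 0 1.
have [t _|r0 [_ H]] := cover R +oo good _ _.
  have [[k lk]|off] := pselect (exists k, rnorm (expi t - l k) < d).
    have e0 : 0 < d - rnorm (expi t - l k) by rewrite subr_gt0.
    near=> s r' => /(_ k); rewrite leNgt => /negP[].
    have : rnorm (expi t - expi s) < d - rnorm (expi t - l k).
      by near: s; exact: near_expi.
    have := rnormD (expi s - expi t) (expi t - l k).
    by rewrite addrA subrK (rnorm_distC (expi s) (expi t)); lra.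
  have off_t k : d <= rnorm (expi t - l k).
    by rewrite leNgt; apply/negP => lk; apply: off; exists k.
  have ut : b - (expi t)%:A \is a GRing.unit.
    apply: b_unit; first exact: rnorm_expi.
    by move=> k; rewrite -subr_eq0 -rnorm_gt0 (lt_le_trans d0).
  have [e e0 [r rP]] := resolvent_locally_bounded ut.
  near=> s r'.
  have ts : rnorm (expi t - expi s) < e by near: s; exact: near_expi.
  have rr' : r <= r' by near: r'; apply: nbhs_pinfty_ge; exact: num_real.
  move=> off_s; apply: le_trans rr'; apply: rP => //.
  apply: b_unit; first exact: rnorm_expi.
  by move=> k; rewrite -subr_eq0 -rnorm_gt0 (lt_le_trans d0).
exists (r0 + 1) => z z1 zl; have [t t01 zt] := expi_surj z1.
rewrite zt; apply: (H (r0 + 1)); rewrite ?ltrDl //= -?zt //.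
by rewrite in_itv /=; case/andP: t01 => -> /ltW.
Unshelve. all: by end_near. Qed.

End ResolventBound.

(** * Annihilation by the polynomial of the spectrum *)

Section Algebraicity.
Context {R : realType} {B : banachAlgType R[i]}.
Local Notation C := R[i].

Lemma doubly_power_boundedP (b : B) : doubly_power_bounded b ->
  exists M : R, forall m : int, rnorm (b ^ m) <= M.
Proof.
move=> [_ [M [_ bM]]]; exists (complex.Re (M + 1)) => m.
have M1 : M < M + 1 by rewrite ltrDl.
have /= bm := bM _ M1 (b ^ m) (ex_intro2 _ _ m I erefl).
by rewrite -rnorm_le RRe_real // (ger0_real (le_trans (normr_ge0 _) bm)).
Qed.

(** In [fejer_annihilator_bound], with [d] fixed, the terms in [1 / N] vanish in the
limit, and what remains is proportional to [d]. *)
Lemma bounded_annihilator_eq0 (n : nat) (b : B) (M : R) (l : 'I_n -> C)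
    (q : B) (q' : 'I_n -> B) :
  b \is a GRing.unit -> (forall m : int, rnorm (b ^ m) <= M) ->
  (forall k, rnorm (l k) = 1) ->
  (forall z, rnorm z = 1 -> (forall k, z != l k) -> b - z%:A \is a GRing.unit) ->
  (forall k, q = q' k * (b - (l k)%:A)) -> q = 0.
Proof.
move=> ub bM l1 b_unit qE; apply/eqP; rewrite -rnorm_eq0 eq_le rnorm_ge0 andbT.
rewrite leNgt; apply/negP => q0.
pose K := \sum_k rnorm (q' k) * 65 * M ^+ 2.
have K0 : 0 <= K.
  apply: sumr_ge0 => k _.
  by rewrite mulr_ge0 ?sqr_ge0 // mulr_ge0 ?rnorm_ge0.
(* The terms proportional to d, and those proportional to 1 / N, each amount to
   at most a quarter of the norm of q. *)
pose d := rnorm q / (8 * (K + 1)).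
have K1 : 0 < 8 * (K + 1) by rewrite mulr_gt0 // ltr_wpDl.
have d0 : 0 < d by rewrite divr_gt0.
have [r rP] := resolvent_bound_off_points d0 b_unit.
pose A := rnorm q * (4 * r ^+ 2 * M ^+ 3) + K.
pose m := Num.bound `|4 * A / rnorm q|.
have N0 : 0 < m.+1%:R :> R by rewrite ltr0n.
have mA : 4 * A < rnorm q * m.+1%:R.
  rewrite [ltRHS]mulrC -ltr_pdivrMr //; apply: le_lt_trans (ler_norm _) _.
  have /lt_trans : `|4 * A / rnorm q| < m%:R by exact: archi_boundP.
  by apply; rewrite ltr_nat.
have H := fejer_annihilator_bound ub (expi_prim_root (R := R) m) bM l1 d0 qE.
have {}H : rnorm q <= rnorm q * (4 * r ^+ 2 * M ^+ 3 / m.+1%:R) +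
   \sum_k rnorm (q' k) * (65 * (M ^+ 2 / m.+1%:R + 2 * d * M ^+ 2)).
  apply: H => z z1 zl; exists (b - z%:A)^-1; last exact: rP.
  rewrite mulVr // b_unit // => k.
  by rewrite -subr_eq0 -rnorm_gt0 (lt_le_trans d0).
move: H.
have -> : \sum_k rnorm (q' k) * (65 * (M ^+ 2 / m.+1%:R + 2 * d * M ^+ 2)) =
    K / m.+1%:R + 2 * d * K.
  rewrite /K mulr_suml mulr_sumr -big_split; apply: eq_bigr => k _ /=.
  by ring.
have dK : 2 * d * K <= rnorm q / 4.
  rewrite /d -mulrA mulrCA mulrAC mulrA ler_pdivrMr //.
  by have := rnorm_ge0 q; nra.
rewrite addrA (_ : rnorm q * _ + _ = A / m.+1%:R); last by rewrite /A; ring.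
have : A / m.+1%:R < rnorm q / 4 by rewrite ltr_pdivrMr //; lra.
by move: (A / m.+1%:R) (2 * d * K) dK => x y; lra.
Qed.

End Algebraicity.

(** * Curve integrals *)

Section CurveIntegrals.
Context {R : realType}.
Local Notation C := (R[i]^o).

Lemma partition_telescope (V : zmodType) (F : R -> V) (s : seq R) :
  itv_partition 0 1 s ->
  \sum_(k < size s) (F s`_k - F (0 :: s)`_k) = F 1 - F 0.
Proof.
move=> [_ /eqP s1]; rewrite -(big_mkord predT (fun k => F s`_k - F (0 :: s)`_k)).
rewrite (eq_bigr (fun k => F (0 :: s)`_k.+1 - F (0 :: s)`_k)) //.
rewrite (telescope_sumr (fun k => F (0 :: s)`_k)) // nth_last /= -[in RHS]s1.
by case: (s).
Qed.

Lemma partition_mem (s : seq R) (k : nat) :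
  itv_partition 0 1 s -> (k < size s)%N ->
  [/\ 0 <= (0 :: s)`_k, (0 :: s)`_k <= s`_k & s`_k <= 1].
Proof.
move=> ps ks; have k1 : (k < size (0%R :: s))%N by rewrite /= ltnS ltnW.
split.
- by rewrite (set_nth_default 1) // (itv_partition_nth_ge (b := 1)) // ltnW.
- by case: ps => /(pathP 0) /(_ k ks) /ltW.
- rewrite -[s`_k]/((0 :: s)`_k.+1) (set_nth_default 1) //.
  exact: (itv_partition_nth_le (a := 0)).
Qed.

Section Fixed.
Context {V : normedModType R[i]} (g : R -> C).

Lemma curve_integral_ext (f f' : C -> V) (v : V) :
  (forall w, trace g w -> f w = f' w) ->
  is_curve_integral g f v -> is_curve_integral g f' v.
Proof.
move=> ff' fv e e0; have [d d0 H] := fv e e0; exists d => // s t ps st.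
rewrite (eq_bigr (fun k : 'I_(size s) => (g s`_k - g (0 :: s)`_k) *: f (g (t k)))).
  exact: H.
move=> k _; rewrite ff' //; exists (t k) => //=.
have [p0 _ p1] := partition_mem ps (ltn_ord k).
have [_ /andP[tk0 tk1]] := st k (ltn_ord k).
by rewrite in_itv /= (le_trans p0 tk0) (le_trans tk1 p1).
Qed.

Lemma curve_integralD (f f' : C -> V) (v v' : V) :
  is_curve_integral g f v -> is_curve_integral g f' v' ->
  is_curve_integral g (fun w => f w + f' w) (v + v').
Proof.
move=> fv f'v e e0; have e20 : 0 < e / 2 by rewrite divr_gt0.
have [d d0 H] := fv _ e20; have [d' d'0 H'] := f'v _ e20.
exists (Num.min d d'); first by rewrite lt_min d0 d'0.
move=> s t ps st.
have {}H := H s t ps; have {}H' := H' s t ps.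
have {}H : `|\sum_(k < size s) (g s`_k - g (0 :: s)`_k) *: f (g (t k)) - v| <
    (e / 2)%:C%C.
  by apply: H => k /st[]; rewrite lt_min => /andP[].
have {}H' : `|\sum_(k < size s) (g s`_k - g (0 :: s)`_k) *: f' (g (t k)) - v'| <
    (e / 2)%:C%C.
  by apply: H' => k /st[]; rewrite lt_min => /andP[].
rewrite !rnorm_lt in H H' *.
under eq_bigr => k _ do rewrite scalerDr.
rewrite big_split opprD addrACA /=; apply: le_lt_trans (rnormD _ _) _; lra.
Qed.

Lemma curve_integralZ (f : C -> C) (u : C) (x : V) :
  is_curve_integral g f u -> is_curve_integral g (fun w => f w *: x) (u *: x).
Proof.
move=> fu e e0; have x1 : 0 < rnorm x + 1 by rewrite ltr_wpDl // rnorm_ge0.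
have [|d d0 H] := fu (e / (rnorm x + 1)); first by rewrite divr_gt0.
exists d => // s t ps st; have := H s t ps st.
rewrite !rnorm_lt ltr_pdivlMr //.
under [X in _ -> rnorm (X - _) < _]eq_bigr => k _ do rewrite scalerA.
rewrite -scaler_suml -scalerBl rnormZ; apply: le_lt_trans.
by rewrite ler_wpM2l ?rnorm_ge0 // lerDl.
Qed.

Lemma curve_integral_lin (n : nat) (f : 'I_n -> C -> C)
    (u : 'I_n -> C) (x : 'I_n -> V) :
  (forall j, is_curve_integral g (f j) (u j)) ->
  is_curve_integral g (fun w => \sum_j f j w *: x j) (\sum_j u j *: x j).
Proof.
elim: n f u x => [|n IH] f u x fu.
  move=> e e0; exists 1 => // s t _ _; rewrite rnorm_lt big_ord0 subr0 big1 ?rnorm0 //.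
  by move=> k _; rewrite big_ord0 scaler0.
rewrite big_ord_recl /=.
have -> : (fun w => \sum_j f j w *: x j) =
    (fun w => f ord0 w *: x ord0 + \sum_(j < n) f (lift ord0 j) w *: x (lift ord0 j)).
  by apply/funext => w; rewrite big_ord_recl.
by apply: curve_integralD; [exact: curve_integralZ|exact: IH].
Qed.

(** [F] is a primitive of [f] along the curve, in the quadratic sense that makes the
errors sum to at most the mesh times a constant. *)
Lemma curve_integral_primitive (f : C -> V) (F : R -> V) (K : R) :
  (forall s u t, 0 <= s -> s <= u -> u <= t -> t <= 1 ->
    rnorm ((g t - g s) *: f (g u) - (F t - F s)) <= K * (t - s) ^+ 2) ->
  is_curve_integral g f (F 1 - F 0).
Proof.
move=> FK e e0; have K1 : 0 < `|K| + 1 by rewrite ltr_wpDl.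
exists (e / (`|K| + 1)); first by rewrite divr_gt0.
move=> s t ps st; rewrite -(partition_telescope F ps) -sumrB rnorm_lt.
apply: le_lt_trans (rnorm_sum _ _ _) _.
apply: (@le_lt_trans _ _
    (\sum_(k < size s) `|K| * (e / (`|K| + 1)) * (s`_k - (0 :: s)`_k))).
  apply: ler_sum => k _; have [p0 p1 p2] := partition_mem ps (ltn_ord k).
  have [sd /andP[tk0 tk1]] := st k (ltn_ord k).
  apply: le_trans (FK _ _ _ p0 tk0 tk1 p2) _.
  apply: (@le_trans _ _ (`|K| * (s`_k - (0 :: s)`_k) ^+ 2)).
    by rewrite ler_wpM2r ?sqr_ge0 // ler_norm.
  by rewrite expr2 -!mulrA ler_wpM2l // mulrA ler_wpM2r ?subr_ge0 // ltW.
rewrite -mulr_sumr (partition_telescope id ps) subr0 mulr1 mulrCA mulrC.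
rewrite gtr_pMl // ltr_pdivrMr // mul1r; lra.
Qed.

(** A uniform limit of integrands with the same integral has that integral: a
Lipschitz curve has finite length, so that its Riemann sums are uniformly
continuous in the integrand. *)
Lemma curve_integral_approx (f : C -> V) (v : V) (L : R) :
  (forall s t, rnorm (g t - g s) <= L * `|t - s|) ->
  (forall e : R, 0 < e -> exists2 f' : C -> V, is_curve_integral g f' v &
    forall w, trace g w -> rnorm (f w - f' w) <= e) ->
  is_curve_integral g f v.
Proof.
move=> gL fv e e0.
have L0 : 0 <= L.
  by have := gL 0 1; rewrite subr0 normr1 mulr1; apply: le_trans; exact: rnorm_ge0.
have L1 : 0 < 2 * (L + 1) by rewrite mulr_gt0 // ltr_wpDl.
have [|f' f'v ff'] := fv (e / (2 * (L + 1))); first by rewrite divr_gt0.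
have e20 : 0 < e / 2 by rewrite divr_gt0.
have [d d0 H] := f'v _ e20; exists d => // s t ps st.
have := H s t ps st; rewrite !rnorm_lt => H1.
set S := \sum_(k < _) _; set S' := \sum_(k < _) _ in H1.
have SS' : rnorm (S - S') <= L * (e / (2 * (L + 1))).
  rewrite -sumrB; apply: le_trans (rnorm_sum _ _ _) _.
  apply: (@le_trans _ _
      (\sum_(k < size s) L * (e / (2 * (L + 1))) * (s`_k - (0 :: s)`_k))).
    apply: ler_sum => k _; have [p0 p1 p2] := partition_mem ps (ltn_ord k).
    have [sd /andP[tk0 tk1]] := st k (ltn_ord k).
    rewrite -scalerBr rnormZ mulrAC ler_pM ?rnorm_ge0 //.
      by rewrite (le_trans (gL _ _)) // ger0_norm // subr_ge0.
    apply: ff'; exists (t k) => //=.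
    by rewrite in_itv /= (le_trans p0 tk0) (le_trans tk1 p2).
  by rewrite -mulr_sumr (partition_telescope id ps) subr0 mulr1.
have : L * (e / (2 * (L + 1))) < e / 2.
  rewrite mulrA ltr_pdivrMr // -mulrA [2^-1 * _]mulrA mulVf // mul1r mulrC.
  by rewrite ltr_pM2l //; lra.
have := rnormD (S - S') (S' - v); rewrite addrA subrK; lra.
Qed.

End Fixed.
End CurveIntegrals.

(** * Circles as Cauchy contours *)

Section Circles.
Context {R : realType}.
Local Notation C := (R[i]^o).

(** The primitive, vanishing at [0], of [expi ((p - 1) * t)] with respect to
[expi t]; the exponent [p = 0] is the logarithmic case. *)
Definition expi_primitive (p t : R) : C :=
  if p == 0 then two_pi_i * t%:C%C else (expi (p * t) - 1) / p%:C%C.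

Lemma expi_primitive0 p : expi_primitive p 0 = 0.
Proof. by rewrite /expi_primitive; case: eqP; rewrite mulr0 // expi0 subrr mul0r. Qed.

Lemma expi_int (p : int) : expi p%:~R = 1 :> C.
Proof.
have H k : expi k%:R = 1 :> C by rewrite -[k%:R]mul1r expiMn expi1 expr1n.
by case: p => k; rewrite ?NegzE ?mulrNz ?expiN !H ?invr1.
Qed.

Lemma expi_primitive1 (p : int) :
  expi_primitive p%:~R 1 = two_pi_i * (p == 0)%:R.
Proof.
rewrite /expi_primitive intr_eq0; case: eqP => [_|_]; first by [].
by rewrite mulr1 expi_int subrr mul0r mulr0.
Qed.

Lemma expi_primitiveB (p s t u : R) :
  expi_primitive p t - expi_primitive p s =
  expi (p * u) * (expi_primitive p (t - u) - expi_primitive p (s - u)).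
Proof.
rewrite /expi_primitive; case: eqP => [->|/eqP p0].
  by rewrite mul0r expi0 mul1r -!mulrBr -!rmorphB /= opprB addrA subrK.
rewrite -!mulrBl mulrA; congr (_ / _).
have E x : expi (p * u) * expi (p * (x - u)) = expi (p * x).
  by rewrite -expiD -mulrDr addrC subrK.
by rewrite -(E t) -(E s); ring.
Qed.

Lemma expi_primitive_linearization (p x : R) :
  rnorm (expi_primitive p x - two_pi_i * x%:C%C) <=
  2 * (2 * pi) ^+ 2 * `|p| * x ^+ 2.
Proof.
rewrite /expi_primitive; case: eqP => [->|/eqP p0].
  by rewrite subrr rnorm0 normr0 mulr0 mul0r.
have pC : p%:C%C != 0 by rewrite fmorph_eq0.
have -> : (expi (p * x) - 1) / p%:C%C - two_pi_i * x%:C%C =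
    (expi (p * x) - 1 - two_pi_i * (p * x)%:C%C) / p%:C%C.
  by rewrite rmorphM /=; field.
rewrite rnormM rnormV rnorm_real ler_pdivrMr ?normr_gt0 //.
apply: le_trans (expi_linearization _) _.
rewrite (exprMn _ p x) -(real_normK (num_real p)) le_eqVlt.
by apply/orP; left; apply/eqP; ring.
Qed.

(** After a rotation by [u] every increment is based at [0], where both sides have
the linear part [two_pi_i * (t - s)]; only second-order errors remain. *)
Lemma expi_stieltjes (p s t u : R) : s <= u -> u <= t ->
  rnorm ((expi t - expi s) * expi ((p - 1) * u) -
    (expi_primitive p t - expi_primitive p s)) <=
  2 * (2 * pi) ^+ 2 * (`|p| + 1) * (t - s) ^+ 2.
Proof.
move=> su ut; rewrite (expi_primitiveB p s t u).
have expiB x : expi x = expi u * expi (x - u) by rewrite -expiD addrC subrK.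
have -> : (expi t - expi s) * expi ((p - 1) * u) -
    expi (p * u) * (expi_primitive p (t - u) - expi_primitive p (s - u)) =
    expi (p * u) * ((expi (t - u) - 1 - two_pi_i * (t - u)%:C%C)
      - (expi (s - u) - 1 - two_pi_i * (s - u)%:C%C)
      - ((expi_primitive p (t - u) - two_pi_i * (t - u)%:C%C)
      - (expi_primitive p (s - u) - two_pi_i * (s - u)%:C%C))).
  have -> : expi ((p - 1) * u) = expi (p * u) / expi u.
    by rewrite mulrBl mul1r expiD expiN.
  rewrite (expiB t) (expiB s); by have eu := expi_neq0 u; field.
rewrite rnormM rnorm_expi mul1r.
apply: le_trans (rnormB _ _) _; apply: le_trans (lerD (rnormB _ _) (rnormB _ _)) _.
have H1 := expi_linearization (t - u); have H2 := expi_linearization (s - u).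
have H3 := expi_primitive_linearization p (t - u).
have H4 := expi_primitive_linearization p (s - u).
apply: le_trans (lerD (lerD H1 H2) (lerD H3 H4)) _.
have c0 : 0 <= 2 * (2 * pi) ^+ 2 * (`|p| + 1) :> R.
  by rewrite mulr_ge0 ?addr_ge0 // mulr_ge0 ?sqr_ge0.
have : 2 * (2 * pi) ^+ 2 * (`|p| + 1) * ((t - u) ^+ 2 + (s - u) ^+ 2) <=
    2 * (2 * pi) ^+ 2 * (`|p| + 1) * (t - s) ^+ 2.
  by rewrite ler_wpM2l //; nra.
apply: le_trans; rewrite le_eqVlt; apply/orP; left; apply/eqP; ring.
Qed.

Definition circle (c : C) (r t : R) : C := c + r%:C%C * expi t.

Lemma circle_lipschitz c r s t : 0 <= r ->
  rnorm (circle c r t - circle c r s) <= r * (4 * pi) * `|t - s|.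
Proof.
move=> r0; rewrite /circle opprD addrACA subrr add0r -mulrBr rnormM rnorm_real.
by rewrite ger0_norm // -mulrA ler_wpM2l // expi_lipschitz.
Qed.

(** Here [f w] is [(w - c) ^ (p - 1)] divided by [r ^ p]; for [p] nonzero its
primitive is periodic. *)
Lemma circle_monomial_integral (c : C) (r : R) (p : int) (f : C -> C) : 0 < r ->
  (forall u, f (circle c r u) = (r%:C%C)^-1 * expi ((p%:~R - 1) * u)) ->
  is_curve_integral (circle c r) f (two_pi_i * (p == 0)%:R).
Proof.
move=> r0 fE; rewrite -expi_primitive1 -[X in is_curve_integral _ _ X]subr0.
rewrite -(expi_primitive0 p%:~R).
apply: (@curve_integral_primitive _ _ _ _ _ (2 * (2 * pi) ^+ 2 * (`|p%:~R| + 1))).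
move=> s u t s0 su ut t1; have := expi_stieltjes p%:~R su ut.
congr (rnorm (_ - _) <= _); rewrite fE /circle /GRing.scale /=.
have rC : r%:C%C != 0 by rewrite fmorph_eq0 gt_eqF.
by field.
Qed.

Lemma trace_circleP (c : C) (r : R) (w : C) : 0 < r ->
  trace (circle c r) w <-> rnorm (w - c) = r.
Proof.
move=> r0; have rC : r%:C%C != 0 by rewrite fmorph_eq0 gt_eqF.
split=> [[t _ <-]|wr].
  by rewrite /circle addrC addKr rnormM rnorm_real rnorm_expi mulr1 gtr0_norm.
have [|t t01 E] := @expi_surj _ ((w - c) / r%:C%C).
  by rewrite rnormM rnormV rnorm_real wr gtr0_norm // divff // gt_eqF.
exists t; first by rewrite /= in_itv /=; case/andP: t01 => -> /ltW.
by rewrite /circle -E mulrC divfK // addrC subrK.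
Qed.

Lemma geometric_remainder (x y : C) (n : nat) : x != 0 -> x != y ->
  (x - y)^-1 - \sum_(k < n) y ^+ k * x ^- k.+1 = (y / x) ^+ n / (x - y).
Proof.
move=> x0 xy; have xy0 : x - y != 0 by rewrite subr_eq0.
elim: n => [|n IH]; first by rewrite big_ord0 subr0 expr0 mul1r.
rewrite big_ord_recr /= opprD addrA IH !exprMn !exprVn !exprS.
have xn : x ^+ n != 0 by rewrite expf_neq0.
by field; rewrite x0 xy0 xn.
Qed.

(** Termwise integration of a series that converges geometrically on the circle. *)
Lemma circle_integral_geometric (c : C) (r : R) (f : C -> C) (v : C) (q A : R)
    (h : nat -> C -> C) (u : nat -> C) :
  0 < r -> 0 <= q < 1 -> 0 <= A ->
  (forall k, is_curve_integral (circle c r) (h k) (u k)) ->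
  (forall n, (0 < n)%N -> \sum_(k < n) u k = v) ->
  (forall n w, trace (circle c r) w ->
     rnorm (f w - \sum_(k < n) h k w) <= A * q ^+ n) ->
  is_curve_integral (circle c r) f v.
Proof.
move=> r0 q01 A0 hu uv fh.
apply: (@curve_integral_approx _ _ _ _ _ (r * (4 * pi))).
  by move=> s t; rewrite circle_lipschitz // ltW.
move=> e e0; have A1 : 0 < A + 1 by rewrite ltr_wpDl.
have [|n0 H] := expr_lt_eps (e := e / (A + 1)) q01; first by rewrite divr_gt0.
exists (fun w => \sum_(k < n0.+1) h k w).
  rewrite -(uv n0.+1) //.
  have -> : \sum_(k < n0.+1) u k = \sum_(k < n0.+1) u k *: (1 : C).
    by apply: eq_bigr => k _; rewrite /GRing.scale /= mulr1.
  apply: curve_integral_ext; last first.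
    apply: (@curve_integral_lin _ _ _ _ (fun k : 'I_n0.+1 => h k)); move=> j; exact: hu.
  by move=> w _; apply: eq_bigr => k _; rewrite /GRing.scale /= mulr1.
move=> w /fh; move=> /(_ n0.+1); move/le_trans; apply.
have := H _ (leqnSn n0); rewrite ltr_pdivlMr // => /ltW; apply: le_trans.
have /andP[q0 _] := q01.
by rewrite mulrC ler_wpM2l ?exprn_ge0 // lerDl.
Qed.

(** The expansion [(w - z)^-1 = \sum_k (z - c) ^+ k * (w - c) ^- k.+1] converges
geometrically on the circle, and only its term [k = 0] has a nonzero integral. *)
Lemma circle_winding_inside (c z : C) (r : R) : rnorm (z - c) < r ->
  is_curve_integral (circle c r) (fun w => (w - z)^-1 : C) two_pi_i.
Proof.
move=> zr; have r0 : 0 < r by apply: le_lt_trans zr; exact: rnorm_ge0.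
have rC : r%:C%C != 0 by rewrite fmorph_eq0 gt_eqF.
pose h k (w : C) : C := (z - c) ^+ k * (w - c) ^- k.+1.
pose u k : C := (z - c) ^+ k / r%:C%C ^+ k * (two_pi_i * ((- k%:Z) == 0)%:R).
apply: (@circle_integral_geometric c r _ _ (rnorm (z - c) / r)
  (r - rnorm (z - c))^-1 h u) => //.
- by rewrite divr_ge0 ?rnorm_ge0 ?ltW // ltr_pdivrMr // mul1r zr.
- by rewrite invr_ge0 subr_ge0 ltW.
- move=> k; pose phi (w : C) := r%:C%C ^+ k * (w - c) ^- k.+1 : C.
  apply: (@curve_integral_ext _ _ _
      (fun w => phi w *: ((z - c) ^+ k / r%:C%C ^+ k : C))).
    move=> w _; rewrite /phi /h /GRing.scale /=.
    have rk : r%:C%C ^+ k != 0 by rewrite expf_neq0.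
    by move: (r%:C%C ^+ k) rk ((w - c) ^- _) ((z - c) ^+ k) => x x0 y y'; field.
  have -> : u k = (two_pi_i * (- k%:Z == 0)%:R) *: ((z - c) ^+ k / r%:C%C ^+ k : C).
    by rewrite /u mulrC.
  apply: curve_integralZ; apply: circle_monomial_integral => // t.
  have -> : ((- k%:Z)%:~R - 1) * t = - (t * k.+1%:R) by rewrite mulrNz -natr1; ring.
  rewrite expiN expiMn /phi /circle addrC addKr exprMn (exprS r%:C%C).
  have rk : r%:C%C ^+ k != 0 by rewrite expf_neq0.
  have tk : expi t ^+ k.+1 != 0 by rewrite expf_neq0 // expi_neq0.
  move: (_ ^+ k) (expi t ^+ k.+1) rk tk => x y x0 y0; field.
  by rewrite x0 y0 rC.
- case=> // n _; rewrite big_ord_recl big1 ?addr0 => [|k _].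
    by rewrite /u !expr0 divr1 !mul1r mulr1.
  by rewrite /u mulr0 mulr0.
- move=> n w /(trace_circleP _ _ r0) wr.
  have -> : w - z = (w - c) - (z - c) by ring.
  have wc0 : w - c != 0 by rewrite -rnorm_gt0 wr.
  have wz : w - c != z - c by apply/eqP => E; move: zr; rewrite -E wr ltxx.
  rewrite geometric_remainder // rnormM rnormX rnormM !rnormV wr mulrC.
  rewrite ler_wpM2r ?exprn_ge0 ?divr_ge0 ?rnorm_ge0 ?(ltW r0) //.
  rewrite lef_pV2 ?posrE ?subr_gt0 //; last by rewrite rnorm_gt0 subr_eq0.
  by rewrite -{1}wr ler_rnorm_dist.
Qed.

(** Here [(w - z)^-1] expands in nonnegative powers of [w - c], which integrate to
zero. *)
Lemma circle_winding_outside (c z : C) (r : R) : 0 < r -> r < rnorm (z - c) ->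
  is_curve_integral (circle c r) (fun w => (w - z)^-1 : C) 0.
Proof.
move=> r0 zr; have z0 : 0 < rnorm (z - c) by exact: lt_trans zr.
have rC : r%:C%C != 0 by rewrite fmorph_eq0 gt_eqF.
pose h k (w : C) : C := - ((w - c) ^+ k * (z - c) ^- k.+1).
pose u (k : nat) : C := 0.
apply: (@circle_integral_geometric c r _ _ (r / rnorm (z - c))
  (rnorm (z - c) - r)^-1 h u) => //.
- by rewrite divr_ge0 ?rnorm_ge0 ?(ltW r0) // ltr_pdivrMr // mul1r zr.
- by rewrite invr_ge0 subr_ge0 ltW.
- move=> k; pose phi (w : C) := (w - c) ^+ k / r%:C%C ^+ k.+1 : C.
  have -> : u k = (two_pi_i * (k.+1%:Z == 0)%:R) *:
      (- (r%:C%C / (z - c)) ^+ k.+1 : C).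
    by rewrite /u mulr0 scale0r.
  apply: (@curve_integral_ext _ _ _
      (fun w => phi w *: (- (r%:C%C / (z - c)) ^+ k.+1 : C))).
    move=> w _; rewrite /phi /h /GRing.scale /= mulrN exprMn exprVn.
    by rewrite mulrA divfK // expf_neq0.
  apply: curve_integralZ; apply: circle_monomial_integral => // t.
  have -> : (k.+1%:Z%:~R - 1) * t = t * k%:R by rewrite -pmulrn -natr1; ring.
  rewrite expiMn /phi /circle addrC addKr exprMn (exprS r%:C%C).
  have rk : r%:C%C ^+ k != 0 by rewrite expf_neq0.
  move: (_ ^+ k) (expi t ^+ k) rk => x y x0; field.
  by rewrite x0 rC.
- by move=> n _; rewrite big1.
- move=> n w /(trace_circleP _ _ r0) wr.
  have -> : w - z = - ((z - c) - (w - c)) by ring.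
  have zc0 : z - c != 0 by rewrite -rnorm_gt0.
  have wz : z - c != w - c by apply/eqP => E; move: zr; rewrite E wr ltxx.
  rewrite invrN sumrN -opprD rnormN geometric_remainder // rnormM rnormX rnormM.
  rewrite !rnormV wr mulrC ler_wpM2r ?exprn_ge0 ?divr_ge0 ?(ltW r0) ?(ltW z0) //.
  rewrite lef_pV2 ?posrE ?subr_gt0 //; last by rewrite rnorm_gt0 subr_eq0.
  by rewrite -{1}wr ler_rnorm_dist.
Qed.

End Circles.

Section CircleContours.
Context {R : realType}.
Local Notation C := (R[i]^o).

Lemma ballC (c w : C) (r : R) : ball c (r%:C%C : R[i]) w <-> rnorm (w - c) < r.
Proof. by rewrite -ball_normE /ball_ /= rnorm_lt rnorm_distC. Qed.

(** A point [w] of the closed disc is approached inside the open disc along the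
segment that joins it to the centre. *)
Lemma closure_ballC (c w : C) (r : R) : 0 < r ->
  closure (ball c (r%:C%C : R[i])) w <-> rnorm (w - c) <= r.
Proof.
move=> r0; split=> [clw|wr B /nbhs_ballP[e e0 eB]].
  rewrite leNgt; apply/negP => rw; have d0 : 0 < rnorm (w - c) - r by rewrite subr_gt0.
  have dC : 0 < (rnorm (w - c) - r)%:C%C :> R[i] by rewrite ltcR.
  have [z [/ballC zc /ballC zw]] := clw _ (nbhsx_ballx w _ dC).
  have := ler_rnorm_dist (w - c) (z - c).
  by rewrite opprB addrA subrK (rnorm_distC w z); lra.
have eE : e = (complex.Re e)%:C%C by rewrite RRe_real // gtr0_real.
have {}e0 : 0 < complex.Re e by rewrite -ltcR -eE.
pose a := Num.min 2^-1 (complex.Re e / (2 * r)).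
have a0 : 0 < a by rewrite /a lt_min invr_gt0 ltr0n divr_gt0 ?mulr_gt0.
have a1 : a <= 2^-1 by rewrite /a ge_min lexx.
have ar : a * r <= complex.Re e / 2.
  have : a <= complex.Re e / (2 * r) by rewrite /a ge_min lexx orbT.
  by rewrite ler_pdivlMr ?mulr_gt0 //; lra.
exists (w + a%:C%C * (c - w)); split.
  apply/ballC; rewrite (_ : _ - c = (1 - a)%:C%C * (w - c)); last first.
    by rewrite rmorphB rmorph1 /=; ring.
  rewrite rnormM rnorm_real ger0_norm; last lra.
  apply: (@le_lt_trans _ _ ((1 - a) * r)); last nra.
  by rewrite ler_wpM2l //; lra.
apply: eB; rewrite eE; apply/ballC.
rewrite addrC addKr rnormM rnorm_real gtr0_norm // rnorm_distC.
by apply: (@le_lt_trans _ _ (a * r)); [rewrite ler_wpM2l // ltW|lra].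
Qed.

Lemma circle_jordan (c : C) (r : R) : 0 < r -> closed_jordan_curve (circle c r).
Proof.
move=> r0; have rC : r%:C%C != 0 :> R[i] by rewrite fmorph_eq0 gt_eqF.
split; last 1 first.
- move=> s t s01 t01; rewrite /circle => /addrI /(mulfI rC); exact: expi_inj.
- apply: continuous_subspaceT => t; apply/cvgrPdist_lt => e e0.
  have eE : e = (complex.Re e)%:C%C by rewrite RRe_real // gtr0_real.
  have {}e0 : 0 < complex.Re e by rewrite -ltcR -eE.
  have K0 : 0 < r * (4 * pi) by rewrite !mulr_gt0 ?pi_gt0.
  apply/nbhs_ballP.
  exists (complex.Re e / (r * (4 * pi))); rewrite /= ?divr_gt0 // => s.
  rewrite /ball /= ltr_pdivlMr // mulrC eE rnorm_lt; apply: le_lt_trans.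
  by apply: circle_lipschitz; exact: ltW.
- by rewrite /circle expi0 expi1.
Qed.

Lemma circle_rectifiable (c : C) (r : R) : 0 < r -> rectifiable (circle c r).
Proof.
move=> r0; exists (r * (4 * pi)) => s ps.
apply: (@le_trans _ _ (\sum_(k < size s) (r * (4 * pi) * (s`_k - (0 :: s)`_k))%:C%C)).
  apply: ler_sum => k _; rewrite rnorm_le.
  have [_ p1 _] := partition_mem ps (ltn_ord k).
  apply: le_trans (circle_lipschitz c _ _ (ltW r0)) _.
  by rewrite ger0_norm // subr_ge0.
by rewrite -rmorph_sum /= lecR -mulr_sumr (partition_telescope id ps) subr0 mulr1.
Qed.

Lemma circle_cauchy_contour (c : C) (r : R) : 0 < r ->
  cauchy_contour (fun _ : 'I_1 => circle c r) (ball c (r%:C%C : R[i])).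
Proof.
move=> r0; have rC : 0 < r%:C%C :> R[i] by rewrite ltcR.
split.
- by move=> _; exact: circle_jordan.
- by move=> _; exact: circle_rectifiable.
- by move=> i j _ _ _; rewrite (ord1 i) (ord1 j).
- exact: ball_open.
- exists (`|c| + r%:C%C); split; first by rewrite ger0_real // addr_ge0 // ltW.
  move=> M cM w /ballC wr /=; apply: le_trans (ltW cM).
  rewrite -[w](subrK c) addrC; apply: le_trans (ler_normD _ _) _.
  by rewrite lerD2l rnorm_le ltW.
- apply/seteqP; split=> w.
    move=> [/(closure_ballC _ _ r0) wr nw]; exists ord0 => //.
    apply/trace_circleP => //; apply/eqP; rewrite eq_le wr leNgt.
    by apply/negP => wr'; apply: nw; apply/ballC.
  move=> [_ _ /(trace_circleP _ _ r0) wr]; split.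
    by apply/closure_ballC; rewrite ?wr.
  by move/ballC; rewrite wr ltxx.
- move=> z /ballC zr; exists (fun=> two_pi_i); last by rewrite big_ord1 mulr1.
  by move=> _; exact: circle_winding_inside.
- move=> z /(closure_ballC _ _ r0) zr; exists (fun=> 0); last by rewrite big_ord1 mulr0.
  by move=> _; apply: circle_winding_outside => //; rewrite ltNge; apply/negP.
Qed.

Lemma circle_separates (n : nat) (l : 'I_n -> C) (i : 'I_n) : injective l ->
  exists2 r : R, 0 < r &
    [/\ ball (l i) (r%:C%C : R[i]) `&` range l = [set l i]
      & separating_contour (range l) (l i) (fun _ : 'I_1 => circle (l i) r)].
Proof.
move=> l_inj.
have [r r0 rl] : exists2 r : R, 0 < r & forall j, j != i -> r < rnorm (l j - l i).
  pose d := \big[Num.min/1]_(j | j != i) rnorm (l j - l i).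
  have d0 : 0 < d.
    apply: lt_bigmin => // j ji.
    by rewrite rnorm_gt0 subr_eq0 (inj_eq l_inj).
  exists (d / 2) => [|j ji]; first by rewrite divr_gt0.
  apply: (@lt_le_trans _ _ d); first by lra.
  exact: bigmin_le_cond.
have ballE : ball (l i) (r%:C%C : R[i]) `&` range l = [set l i].
  apply/seteqP; split=> [w [/ballC wr [j _ wE]]|_ ->].
    rewrite /= -wE; have [->//|/rl] := eqVneq j i.
    by rewrite wE => /(lt_trans wr); rewrite ltxx.
  split; last by exists i.
  by apply/ballC; rewrite subrr rnorm0.
exists r => //; split=> //; exists (ball (l i) (r%:C%C : R[i])); split=> //.
  exact: circle_cauchy_contour.
apply/seteqP; split=> // w [[_ _ /(trace_circleP _ _ r0) wr] [j _ wE]].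
have [ji|/rl] := eqVneq j i; last by rewrite wE wr ltxx.
by move: wr; rewrite -wE ji subrr rnorm0 => r0'; rewrite -r0' ltxx in r0.
Qed.

End CircleContours.

(** * The equivalence and the Riesz projections *)

Section Equivalence.
Context {R : realType} {B : banachAlgType R[i]} {n : nat}.
Local Notation C := R[i].
Implicit Types (b : B) (l : 'I_n -> C) (p : 'I_n -> B).

Lemma spectral_decompositionP b l p : spectral_decomposition b l p <->
  [/\ resolution p, b = diagonal p l & forall i, p i != 0].
Proof. by split=> [[p0 p1 pp bE]|[[p1 pp] bE p0]]; split. Qed.

Lemma spectrum_diagonal p l : resolution p -> (forall i, p i != 0) ->
  spectrum (diagonal p l) = range l.
Proof.
move=> p_res p0; apply/seteqP; split=> [w /= wN|_ [i _ <-] /=]; last first.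
  rewrite /spectrum /= diagonalBA //.
  by apply: (@diagonal_singular _ _ _ _ p_res _ i); rewrite ?subrr.
apply: contrapT => wl; move/negP: wN; apply.
rewrite diagonalBA //; apply: (proj1 (diagonal_unit p_res _)) => j.
by rewrite subr_eq0; apply/eqP => lw; apply: wl; exists j.
Qed.

(** If [p i] were zero, the [i]-th coordinate could be changed freely, and
[diagonal p l - l i] would be invertible. *)
Lemma resolution_neq0 p l i : resolution p -> injective l ->
  spectrum (diagonal p l) (l i) -> p i != 0.
Proof.
move=> p_res l_inj /negP li; apply/negP => /eqP pi0; apply: li.
rewrite diagonalBA //.
have -> : diagonal p (fun j => l j - l i) =
    diagonal p (fun j => if j == i then 1 else l j - l i).
  by apply: eq_bigr => j _; case: eqP => // ->; rewrite pi0 !scaler0.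
apply: (proj1 (diagonal_unit p_res _)) => j.
have [_|ji] := eqVneq j i; first exact: oner_neq0.
by rewrite subr_eq0 (inj_eq l_inj).
Qed.

(** [spectrum_le1] applies to [b] and to [b^-1], whose spectrum contains [w^-1]. *)
Lemma spectrum_on_circle b (M : R) (w : C) : b \is a GRing.unit ->
  (forall m : int, rnorm (b ^ m) <= M) -> spectrum b w -> rnorm w = 1.
Proof.
move=> ub bM bw; apply/eqP; rewrite eq_le.
have w0 : 0 < rnorm w.
  rewrite rnorm_gt0; apply/eqP => w0; move: bw.
  by rewrite /spectrum /= w0 scale0r subr0 ub.
rewrite (spectrum_le1 (rnorm_expr bM) bw) /=.
have bVM k : rnorm (b^-1 ^+ k) <= M by rewrite exprVn; exact: rnorm_exprV bM k.
by have := spectrum_le1 bVM (spectrumV ub bw); rewrite rnormV invf_le1.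
Qed.

(** [bounded_annihilator_eq0] applied to the annihilator, from which each factor
[b - l k] can be split off. *)
Lemma doubly_power_bounded_annihilated b l : doubly_power_bounded b ->
  spectrum b = range l ->
  (forall i, rnorm (l i) = 1) /\ horner_alg b (annihilator l) = 0.
Proof.
move=> bdd sp; have [ub _] := bdd; have [M bM] := doubly_power_boundedP bdd.
have l1 i : rnorm (l i) = 1.
  by apply: (spectrum_on_circle ub bM); rewrite sp; exists i.
split=> //.
apply: (@bounded_annihilator_eq0 _ _ n b M l _
  (fun k => horner_alg b (\prod_(j | j != k) ('X - (l j)%:P)))) => //.
- move=> z _ zl; apply: contraT => bz.
  have : spectrum b z by [].
  by rewrite sp => -[k _ lk]; have := zl k; rewrite lk eqxx.
- move=> k; rewrite -horner_algXsubC -rmorphM /annihilator (bigD1 k) //=.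
  by rewrite mulrC.
Qed.

Lemma diagonal_doubly_power_bounded p l : resolution p ->
  (forall i, rnorm (l i) = 1) -> doubly_power_bounded (diagonal p l).
Proof.
move=> p_res l1; have l0 i : l i != 0 by rewrite -rnorm_gt0 l1.
split; first exact: (proj1 (diagonal_unit p_res l0)).
have S0 : 0 <= \sum_i rnorm (p i) by apply: sumr_ge0 => i _; exact: rnorm_ge0.
exists (\sum_i rnorm (p i))%:C%C; split; first by rewrite ger0_real // ler0c.
move=> M SM _ [m _ <-] /=; apply: le_trans (ltW SM).
rewrite rnorm_le diagonal_exprz //; apply: le_trans (rnorm_sum _ _ _) _.
apply: ler_sum => i _; rewrite rnormZ.
have lm : rnorm (l i ^ m) = 1.
  by case: m => k; rewrite ?NegzE -?exprnN ?rnormV rnormX l1 expr1n ?invr1.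
by rewrite lm mul1r.
Qed.

Lemma resolvent_diagonal p l (w : C) : resolution p -> (forall j, w != l j) ->
  (w%:A - diagonal p l)^-1 = \sum_j (w - l j)^-1 *: p j.
Proof.
move=> p_res wl; have -> : w%:A - diagonal p l = diagonal p (fun j => w - l j).
  rewrite -opprB diagonalBA // /diagonal -sumrN; apply: eq_bigr => j _.
  by rewrite -scaleNr opprB.
by rewrite (proj2 (diagonal_unit p_res _)) // => j; rewrite subr_eq0.
Qed.

(** A point [l j] other than [l i] lies neither in [D] nor on its boundary, hence
outside of the closure of [D], where the winding number is zero. *)
Lemma diagonal_riesz_projection p l i : resolution p -> (forall i, p i != 0) ->
  injective l -> is_riesz_projection (diagonal p l) (l i) (p i).
Proof.
move=> p_res p0 l_inj; rewrite /is_riesz_projection spectrum_diagonal //.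
have [r r0 [ballE sep]] := circle_separates i l_inj.
split.
- split; first by apply/mem_set; exists i.
  exists (ball (l i : C^o) (r%:C%C : C)) => //; apply: nbhsx_ballx.
  by rewrite ltcR.
- by exists 1%N, (fun=> circle (l i) r).
move=> m G [D [contour DA traceA]].
have winding j : has_winding_number G (l j) (i == j)%:R.
  have [<-|ij] := eqVneq i j.
    apply: (cauchy_inside contour).
    by have : [set l i] (l i) by []; rewrite -DA => -[].
  have Dj : ~ D (l j).
    move=> Dlj; have : (D `&` range l) (l j) by split=> //; exists j.
    by rewrite DA /= => /l_inj ji; move/eqP: ij; apply.
  apply: (cauchy_outside contour) => clj.
  have : (closure D `\` D) (l j) by [].
  rewrite (cauchy_boundary contour) => Tj.
  have : ((\bigcup_k trace (G k)) `&` range l) (l j) by split=> //; exists j.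
  by rewrite traceA.
pose I j := projT1 (cid2 (winding j)).
have IP j k : is_curve_integral (G k) (fun w : C^o => (w - l j)^-1 : C^o) (I j k).
  by rewrite /I; case: cid2 => /= x xP _; exact: xP.
have IE j : two_pi_i * (i == j)%:R = \sum_k I j k.
  by rewrite /I; case: cid2 => /= x _ <-; case: eqP.
exists (two_pi_i *: p i); last first.
  rewrite scalerA mulVf ?scale1r // /two_pi_i eq_complex /= eqxx /=.
  by rewrite mulf_neq0 // gt_eqF // pi_gt0.
exists (fun k => \sum_j I j k *: p j).
  move=> k; apply: curve_integral_ext (curve_integral_lin _ (fun j => IP j k)).
  move=> w Gw; rewrite resolvent_diagonal // => j; apply/eqP => wl.
  have : ((\bigcup_k trace (G k)) `&` range l) w.
    by split; [exists k|exists j].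
  by rewrite traceA.
rewrite exchange_big (bigD1 i) //= -scaler_suml -IE eqxx mulr1.
rewrite big1 ?addr0 // => j ji; rewrite -scaler_suml -IE eq_sym (negbTE ji).
by rewrite mulr0 scale0r.
Qed.

End Equivalence.

Theorem theorem4p2 (R : realType) (B : banachAlgType R[i]) (b : B)
    (n : nat) (l : 'I_n -> R[i]) :
  b \is a GRing.unit -> (0 < n)%N -> injective l ->
  [<-> doubly_power_bounded b /\ spectrum b = range l;
       (forall i, `|l i| = 1) /\ exists p, spectral_decomposition b l p;
       [/\ forall i, `|l i| = 1,
           \prod_(j < n) (b - (l j)%:A) = 0
         & forall i, lagrange_idempotent b l i != 0]] /\
  (doubly_power_bounded b /\ spectrum b = range l -> (1 < n)%N ->
   forall i, is_riesz_projection b (l i) (lagrange_idempotent b l i)).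
Proof.
move=> ub n0 l_inj.
pose L i := horner_alg b (lagrange l i).
have LE : lagrange_idempotent b l = L.
  by apply/funext => i; rewrite /L horner_lagrange.
have norm1 (z : R[i]) : `|z| = 1 <-> rnorm z = 1.
  by rewrite rnormE; split=> [/(@complexI R)|->].
have decomposition : doubly_power_bounded b -> spectrum b = range l ->
    (forall i, rnorm (l i) = 1) /\ spectral_decomposition b l L.
  move=> bdd sp; have [l1 b0] := doubly_power_bounded_annihilated bdd sp.
  have [L_res bE] := lagrange_resolution l_inj b0; split=> //.
  apply/spectral_decompositionP; split=> // i.
  by apply: (@resolution_neq0 _ _ _ _ l) => //; rewrite -bE sp; exists i.
split; last first.
  move=> [bdd sp] _ i; rewrite LE.
  have [_ /spectral_decompositionP[L_res bE L0]] := decomposition bdd sp.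
  rewrite [X in is_riesz_projection X]bE; exact: diagonal_riesz_projection.
tfae.
- move=> [bdd sp]; have [l1 Ldec] := decomposition bdd sp.
  by split; [move=> i; apply/norm1|exists L].
- move=> [l1 [p /spectral_decompositionP[p_res bE p0]]]; split=> //.
    rewrite -horner_annihilator bE diagonal_horner // /diagonal big1 // => j _.
    by rewrite /annihilator (bigD1 j) //= hornerM hornerXsubC subrr mul0r scale0r.
  move=> i; rewrite LE /L bE diagonal_horner //.
  have -> : diagonal p (fun j => (lagrange l i).[l j]) = p i.
    rewrite -[RHS](diagonal_delta p i); apply: diagonal_ext => j.
    by rewrite lagrangeE // eq_sym.
  exact: p0.
- move=> [/(_ _)/norm1 l1 b0 L0]; rewrite -horner_annihilator in b0.
  have [L_res bE] := lagrange_resolution l_inj b0.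
  split; first by rewrite bE; exact: diagonal_doubly_power_bounded.
  rewrite bE; apply: spectrum_diagonal => // i.
  by have := L0 i; rewrite LE.
Qed.
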